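(* Let $F_{\alpha,\beta}=\{f^n_{\alpha(n),\beta(n)}\}_{n\in\mathbb{N}_0}$ be an arbitrary Fučík system for the Neumann Laplacian on $(0,\pi)$, and let $\phi_0\equiv\frac{\sqrt2}{2}$. Then $F_{\alpha,\beta}$ is complete in $L^2(0,\pi)$. Moreover, the system $$\Big\{f^n_{\alpha(n),\beta(n)}-\frac{\sqrt2}{\pi}\langle f^n_{\alpha(n),\beta(n)},\phi_0\rangle\Big\}_{n\in\mathbb{N}}$$ is a Riesz basis in the space $L^2_\perp(0,\pi):=\{u\in L^2(0,\pi): \langle u,\phi_0\rangle=0\}$.
   Context: $L^2(0,\pi)$ is the real Hilbert space with standard scalar product $\langle u,v\rangle=\int_0^\pi uv\,dx$ and norm $\|\cdot\|$; $\mathbb{N}=\{1,2,\dots\}$, $\mathbb{N}_0=\mathbb{N}\cup\{0\}$. For $n\in\mathbb{N}$ let $\Gamma_n=\{(\alpha,\beta): \alpha,\beta>0,\ \frac n2\frac{\pi}{\sqrt\alpha}+\frac n2\frac{\pi}{\sqrt\beta}=\pi\}$. For $(\alpha,\beta)\in\Gamma_n$, the normalized Fučík eigenfunction $f^n_{\alpha,\beta}$ is the $C^2$-solution of $-u''=\alpha u^+-\beta u^-$ in $(0,\pi)$, $u'(0)=u'(\pi)=0$ (where $u^\pm=\max\{\pm u,0\}$) with $f^n_{\alpha,\beta}(0)>0$ and $\sup_{[0,\pi]}|f^n_{\alpha,\beta}|=1$. Explicitly, with $l_1=\pi/\sqrt\alpha$, $l_2=\pi/\sqrt\beta$, $l=l_1+l_2=2\pi/n$,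 $k\in\mathbb{Z}$: if $\alpha\ge n^2\ge\beta$, then $f^n_{\alpha,\beta}(x)=\frac{\sqrt\beta}{\sqrt\alpha}\cos(\sqrt\alpha(x-kl))$ for $kl-\frac{l_1}{2}\le x<kl+\frac{l_1}{2}$ and $f^n_{\alpha,\beta}(x)=-\cos(\sqrt\beta(x-\frac{2k+1}{2}l))$ for $\frac{2k+1}{2}l-\frac{l_2}{2}\le x<\frac{2k+1}{2}l+\frac{l_2}{2}$; if $\beta>n^2>\alpha$, then on the same intervals $f^n_{\alpha,\beta}(x)=\cos(\sqrt\alpha(x-kl))$ and $f^n_{\alpha,\beta}(x)=-\frac{\sqrt\alpha}{\sqrt\beta}\cos(\sqrt\beta(x-\frac{2k+1}{2}l))$, respectively. For $n=0$ set $f^0_{\alpha,\beta}\equiv\frac{\sqrt2}{2}$. A Fučík system is a sequence $F_{\alpha,\beta}=\{f^n_{\alpha(n),\beta(n)}\}_{n\in\mathbb{N}_0}$ where $\alpha,\beta:\mathbb{N}_0\to\mathbb{R}$ satisfy $\alpha(0)=\beta(0)=0$ and $(\alpha(n),\beta(n))\in\Gamma_n$ for every $n\ge1$. $F_{\alpha,\beta}$ is complete in $L^2(0,\pi)$ if for every $f\in L^2(0,\pi)$ and every $\varepsilon>0$ there exist real constants $\{c_n\}_{n\in\mathbb{N}_0}$ and $N_0\in\mathbb{N}_0$ such that $\|f-\sum_{n=0}^N c_nf^n_{\alpha(n),\beta(n)}\|\le\varepsilon$ for every $N\ge N_0$. A sequence in a Hilbert space $H$ is a Riesz basis in $H$ if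 it is the image of a complete orthonormal system of $H$ under some linear homeomorphism of $H$. *)

(* Defs.v *)
From HB Require Import structures.
From mathcomp Require Import all_boot all_order all_algebra.
From mathcomp Require Import all_classical all_reals all_analysis.

Set Implicit Arguments.
Unset Strict Implicit.
Unset Printing Implicit Defensive.

Import Order.TTheory GRing.Theory Num.Theory.
Import numFieldNormedType.Exports.

Local Open Scope classical_set_scope.
Local Open Scope ring_scope.

(* Elements of L^2(0, pi) are represented by functions R -> R, of which only
   the values on ]0, pi[ matter; equality in L^2(0, pi) is [eqL2]. *)
Section L2.
Context {R : realType}.
Implicit Types (u v : R -> R) (H : set (R -> R)) (T : (R -> R) -> R -> R)
  (F : nat -> R -> R).

Notation mu := (@lebesgue_measure R).

Definition dom0pi : set R := `]0, pi[.

Definition L2 : set (R -> R) := [set u | u \_ dom0pi \in Lfun mu 2%:E].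

Definition eqL2 u v := u = v %[ae mu in dom0pi].

Definition innerL2 u v : R := \int[mu]_(x in dom0pi) (u x * v x).

Definition normL2 u : R := Num.sqrt (innerL2 u u).

(* In the following definitions H is a subspace of L^2(0, pi), given by the set
   of all square-integrable representatives of its elements. *)

Definition complete_in H F :=
  (forall n, H (F n)) /\
  forall u, H u -> forall e : R, 0 < e ->
    exists (c : nat -> R) (N0 : nat), forall N, (N0 <= N)%N ->
      normL2 (fun x => u x - \sum_(0 <= n < N.+1) c n * F n x) <= e.

Definition orthonormal F := forall m n, innerL2 (F m) (F n) = (m == n)%:R.

(* T induces a well-defined continuous linear map H -> H on classes. *)
Definition continuous_linear H T :=
  [/\ forall u, H u -> H (T u),
      forall u v, H u -> H v -> eqL2 u v -> eqL2 (T u) (T v),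
      forall (a : R) u v, H u -> H v ->
        eqL2 (T (fun x => a * u x + v x)) (fun x => a * T u x + T v x) &
      forall u, H u -> forall e : R, 0 < e -> exists2 d : R, 0 < d &
        forall v, H v -> normL2 (fun x => v x - u x) < d ->
          normL2 (fun x => T v x - T u x) < e].

Definition linear_homeomorphism H T :=
  continuous_linear H T /\
  exists S, [/\ continuous_linear H S,
                forall u, H u -> eqL2 (S (T u)) u &
                forall u, H u -> eqL2 (T (S u)) u].

Definition riesz_basis_in H F :=
  exists (e : nat -> R -> R) T,
    [/\ complete_in H e, orthonormal e, linear_homeomorphism H T &
        forall n, H (F n) /\ eqL2 (T (e n)) (F n)].

End L2.

Section Fucik.
Context {R : realType}.

Definition phi0 : R -> R := fun=> Num.sqrt 2 / 2.

Definition L2perp : set (R -> R) := [set u | L2 u /\ innerL2 u phi0 = 0].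

Definition Gamma (n : nat) : set (R * R) :=
  [set ab | [/\ 0 < ab.1, 0 < ab.2 &
    n%:R / 2 * (pi / Num.sqrt ab.1) + n%:R / 2 * (pi / Num.sqrt ab.2) = pi]].

(* C^2 in the open interval, C^1 up to the boundary: the Neumann conditions
   u'(0) = u'(pi) = 0 are expressed by the boundary limits of u'. *)
Definition neumann_fucik_solution (a b : R) (u : R -> R) :=
  [/\ derivable_oo_LRcontinuous u 0 pi,
      {in `]0, pi[, forall x, derivable (derive1 u) x 1},
      {in `]0, pi[, continuous (derive1 (derive1 u))},
      {in `]0, pi[, forall x, - derive1 (derive1 u) x = a * u^\+ x - b * u^\- x} &
      derive1 u y @[y --> 0^'+] --> 0 /\ derive1 u y @[y --> pi^'-] --> 0].

Definition normalized_fucik_eigenfunction (n : nat) (a b : R) (u : R -> R) :=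
  if n is 0 then {in `[0, pi], u =1 phi0}
  else [/\ neumann_fucik_solution a b u,
           0 < u 0 &
           sup [set `|u x| | x in `[0, pi]] = 1].

Definition fucik_system (alpha beta : nat -> R) (f : nat -> R -> R) :=
  [/\ alpha 0%N = 0, beta 0%N = 0,
      forall n, (0 < n)%N -> Gamma n (alpha n, beta n) &
      forall n, normalized_fucik_eigenfunction n (alpha n) (beta n) (f n)].

End Fucik.

(* Main.v *)
Require Import Defs.
From HB Require Import structures.
From mathcomp Require Import all_boot all_order all_algebra.
From mathcomp Require Import all_classical all_reals all_analysis.
From mathcomp Require Import measurable_realfun ring lra.

Set Implicit Arguments.
Unset Strict Implicit.
Unset Printing Implicit Defensive.

Import Order.TTheory GRing.Theory Num.Theory.
Import numFieldNormedType.Exports.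

Local Open Scope classical_set_scope.
Local Open Scope ring_scope.

(** After subtraction of its mean, the n-th eigenfunction only has the frequencies
k n, k >= 1, in its cosine expansion. Up to the common factor sqrt (2 / pi) n, its
coefficient at k n is J(k n), the integral of the half wave against cos(k n y),
and integrating by parts on the positive and on the negative part gives
(k^2 n^2 - t^2) J(k n) = (s^2 - t^2) I(k n), where s = sqrt alpha, t = sqrt beta,
and I is the integral over the positive part. If t <= s (the other case follows
by reflection) then |I(k n)| is at most the integral 1/s of the positive cosine
bump, relative to its amplitude, while I(n) is at least the integral pi/(4 s) of
its square. As n/2 < t <= n, this yields
|J(k n)| <= (3 / pi) / (k^2 - 1/4) * J(n), and these factors sum to 2 / pi < 1
over k >= 2: by Schur's test the system is, uniformly in alpha and beta, a relative
perturbation of norm < 1 of a diagonal rescaling of the cosine basis. The matrix of the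
perturbation is triangular for divisibility, so it can be inverted on arbitrary
sequences by recursion, and only finite sums have to be estimated. *)

(** * The space L^2(0, pi) *)

(** An eigenfunction is given only as a solution of the differential equation with supremum 1. Its
    profile is recovered half period by half period from uniqueness for the initial value problem,
    and its amplitude u(0) from the normalization. Its even extension has period 2 pi / n, which is
    why only multiples of n occur as frequencies.

    The curve [Gamma n] says that n is the harmonic mean of s and t. For t <= s this gives n/2 < t
    <= n, so the estimates do not degenerate as s grows.

    The factor bounding the entry at (k n, n) depends on k only. The off-diagonal part is therefore
    dominated by the sum over k of these factors times the dilation of indices by k, which has norm
    1, and smallness reduces to one numerical series. The diagonal need only stay between two
    positive constants, uniformly in n.

    Elements of L^2 are functions up to null sets, so operators are built on coefficient sequences
    and carried over to functions by the Riesz-Fischer theorem and uniqueness of coefficients. *)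

Section L2_space.
Context {R : realType}.
Implicit Types (u v w : R -> R).

Notation mu := (@lebesgue_measure R).
Notation D := (@dom0pi R).
Notation integ u := (mu.-integrable D (EFin \o u)).

Lemma measurable_dom0pi : measurable (D : set (measurableTypeR R)).
Proof. exact: measurable_itv. Qed.
#[local] Hint Resolve measurable_dom0pi : core.

Lemma lebesgue_dom0pi : mu D = (pi : R)%:E.
Proof. by rewrite /dom0pi lebesgue_measure_itv/= lte_fin pi_gt0 oppr0 adde0. Qed.

Lemma L2P u : L2 u <-> measurable_fun D u /\ integ (fun x => u x ^+ 2).
Proof.
have sqD : EFin \o (fun x => (u \_ D) x ^+ 2) = (EFin \o (fun x => u x ^+ 2)) \_ D.
  by apply/funext => x; rewrite /= !patchE; case: ifP => //; rewrite expr0n.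
split=> [uL2|[mu_ iu]].
  have := uL2; rewrite /L2/= inE => /andP[mu_ _]; rewrite inE/= in mu_.
  split; first by apply/(measurable_restrictT u measurable_dom0pi).
  have := Lfun2_integrable_sqr uL2; rewrite sqD.
  exact: (proj2 (@integrable_mkcond _ _ _ mu D _ measurable_dom0pi)).
rewrite /L2/= inE; apply/andP; split; rewrite inE/=.
  by apply/(measurable_restrictT u measurable_dom0pi).
move/(proj1 (@integrable_mkcond _ _ _ mu D _ measurable_dom0pi)) : iu; rewrite -sqD.
move=> /integrableP[_]; rewrite /finite_norm unlock /Lnorm/= => h.
rewrite poweR_lty//; apply: le_lt_trans h; rewrite le_eqVlt; apply/orP; left.
apply/eqP/eq_integral => x _ /=.
by rewrite powR_mulrn// normrX.
Qed.

Lemma L2_measurable u : L2 u -> measurable_fun D u.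
Proof. by move=> /L2P[]. Qed.

(** This domination makes the product of two square-integrable functions integrable. *)
Lemma ler_normM_sqrD (a b : R) : `|a * b| <= `|a ^+ 2 + b ^+ 2|.
Proof.
rewrite [leRHS]ger0_norm ?addr_ge0 ?sqr_ge0// ler_norml.
have := sqr_ge0 (a - b); have := sqr_ge0 (a + b).
by have := sqr_ge0 a; have := sqr_ge0 b => *; apply/andP; split; nra.
Qed.

Lemma L2_integrableM u v : L2 u -> L2 v -> integ (fun x => u x * v x).
Proof.
move=> /L2P[mu_ iu] /L2P[mv iv].
apply: (@le_integrable _ _ _ mu D measurable_dom0pi _
  (EFin \o (fun x => u x ^+ 2 + v x ^+ 2))).
- by apply/measurable_EFinP; exact: measurable_funM.
- by move=> x _ /=; rewrite lee_fin ler_normM_sqrD.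
- by have := integrableD measurable_dom0pi iu iv; apply: eq_integrable.
Qed.

Lemma L2Zl (a : R) u : L2 u -> L2 (fun x => a * u x).
Proof.
move=> /L2P[mu_ iu]; apply/L2P; split; first exact: measurable_funM.
have := integrableZl measurable_dom0pi (a ^+ 2) iu.
by apply: eq_integrable => // x _ /=; rewrite -EFinM exprMn.
Qed.

Lemma L2D u v : L2 u -> L2 v -> L2 (fun x => u x + v x).
Proof.
move=> uL2 vL2; have /L2P[mu_ iu] := uL2; have /L2P[mv iv] := vL2.
apply/L2P; split; first exact: measurable_funD.
have iuv := integrableZl measurable_dom0pi 2 (L2_integrableM uL2 vL2).
have := integrableD measurable_dom0pi (integrableD measurable_dom0pi iu iv) iuv.
by apply: eq_integrable => // x _ /=; rewrite -EFinM -!EFinD; congr EFin; ring.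
Qed.

Lemma L2_linear (a : R) u v : L2 u -> L2 v -> L2 (fun x => a * u x + v x).
Proof. by move=> /(L2Zl a); exact: L2D. Qed.

Lemma L2B u v : L2 u -> L2 v -> L2 (fun x => u x - v x).
Proof.
move=> uL2 /(L2Zl (-1)) vL2; have := L2D uL2 vL2.
by under eq_fun do rewrite mulN1r.
Qed.

Lemma L2_cst (a : R) : L2 (fun=> a).
Proof.
apply/L2P; split=> //; apply: measurable_bounded_integrable => //.
  by rewrite [X in (X < _)%E]lebesgue_dom0pi ltry.
by exists (`|a ^+ 2|); split=> // M aM x _; exact: ltW.
Qed.

Lemma L2_sum (I : Type) (r : seq I) (P : pred I) (w : I -> R -> R) :
  (forall i, L2 (w i)) -> L2 (fun x => \sum_(i <- r | P i) w i x).
Proof.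
move=> wL2; elim: r => [|i r ih].
  by under eq_fun do rewrite big_nil; exact: L2_cst.
under eq_fun do rewrite big_cons; case: (P i) => //; exact: L2D.
Qed.

Lemma L2_bounded u (M : R) : measurable_fun D u -> (forall x, D x -> `|u x| <= M) ->
  L2 u.
Proof.
move=> mu_ uM; apply/L2P; split=> //.
have /L2P[_] := L2_cst M; apply: le_integrable => //.
  by apply/measurable_EFinP; exact: measurable_funX.
move=> x Dx; rewrite /= lee_fin !normrX lerXn2r ?nnegrE//.
by rewrite (le_trans (uM x Dx))// ler_norm.
Qed.

Lemma L2_integrable u : L2 u -> integ u.
Proof.
move=> /L2_integrableM-/(_ _ (L2_cst 1)).
by apply: eq_integrable => // x _ /=; rewrite mulr1.
Qed.

Lemma innerL2C u v : innerL2 u v = innerL2 v u.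
Proof. by apply: eq_Rintegral => x _; rewrite mulrC. Qed.

Lemma innerL2_linearl (a : R) u v w : L2 u -> L2 v -> L2 w ->
  innerL2 (fun x => a * u x + v x) w = a * innerL2 u w + innerL2 v w.
Proof.
move=> uL2 vL2 wL2; rewrite /innerL2 -RintegralZl//; last exact: L2_integrableM.
rewrite -RintegralD//.
- by apply: eq_Rintegral => x _; rewrite mulrDl mulrA.
- have := L2_integrableM (L2Zl a uL2) wL2.
  by apply: eq_integrable => // x _ /=; rewrite mulrA.
- exact: L2_integrableM.
Qed.

Lemma innerL2Dl u v w : L2 u -> L2 v -> L2 w ->
  innerL2 (fun x => u x + v x) w = innerL2 u w + innerL2 v w.
Proof.
move=> uL2 vL2 wL2; rewrite -[innerL2 u w]mul1r -innerL2_linearl//.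
by under [in RHS]eq_fun do rewrite mul1r.
Qed.

Lemma innerL2Zl (a : R) u w : L2 u -> L2 w ->
  innerL2 (fun x => a * u x) w = a * innerL2 u w.
Proof.
move=> uL2 wL2; rewrite /innerL2 -RintegralZl//; last exact: L2_integrableM.
by apply: eq_Rintegral => x _; rewrite mulrA.
Qed.

Lemma innerL2Bl u v w : L2 u -> L2 v -> L2 w ->
  innerL2 (fun x => u x - v x) w = innerL2 u w - innerL2 v w.
Proof.
move=> uL2 vL2 wL2; rewrite -mulN1r -innerL2Zl// -innerL2Dl//; last exact: L2Zl.
by under [in RHS]eq_fun do rewrite mulN1r.
Qed.

Lemma innerL2_suml (I : Type) (r : seq I) (P : pred I) (w : I -> R -> R) v :
  (forall i, L2 (w i)) -> L2 v ->
  innerL2 (fun x => \sum_(i <- r | P i) w i x) v =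
  \sum_(i <- r | P i) innerL2 (w i) v.
Proof.
move=> wL2 vL2; elim: r => [|i r ih].
  rewrite big_nil /innerL2 (@eq_Rintegral _ _ _ _ _ (cst 0)) ?Rintegral_cst ?mul0r//.
  by move=> x _; rewrite big_nil mul0r.
under [in LHS]eq_fun do rewrite big_cons.
rewrite big_cons; case: (P i) => //.
by rewrite innerL2Dl// ?ih//; exact: L2_sum.
Qed.

Lemma innerL2Dr u v w : L2 u -> L2 v -> L2 w ->
  innerL2 w (fun x => u x + v x) = innerL2 w u + innerL2 w v.
Proof. by move=> *; rewrite ![innerL2 w _]innerL2C innerL2Dl. Qed.

Lemma innerL2Zr (a : R) u w : L2 u -> L2 w ->
  innerL2 w (fun x => a * u x) = a * innerL2 w u.
Proof. by move=> *; rewrite ![innerL2 w _]innerL2C innerL2Zl. Qed.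

Lemma innerL2Br u v w : L2 u -> L2 v -> L2 w ->
  innerL2 w (fun x => u x - v x) = innerL2 w u - innerL2 w v.
Proof. by move=> *; rewrite ![innerL2 w _]innerL2C innerL2Bl. Qed.

Lemma innerL2_ge0 u : 0 <= innerL2 u u.
Proof. by apply: Rintegral_ge0 => x _; rewrite -expr2 sqr_ge0. Qed.

Lemma normL2_le u (e : R) : 0 <= e -> (normL2 u <= e) = (innerL2 u u <= e ^+ 2).
Proof.
move=> e0; rewrite /normL2 -[X in _ <= X]ger0_norm// -sqrtr_sqr ler_sqrt//.
exact: sqr_ge0.
Qed.

Lemma normL2_lt u (e : R) : 0 < e -> (normL2 u < e) = (innerL2 u u < e ^+ 2).
Proof.
move=> e0; rewrite /normL2 -[X in _ < X]gtr0_norm// -sqrtr_sqr ltr_sqrt//.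
exact: exprn_gt0.
Qed.

Lemma filterS_ae (P Q : R -> Prop) : (forall x, P x -> Q x) ->
  (\forall x \ae mu, P x) -> \forall x \ae mu, Q x.
Proof. by move=> PQ; apply: (@filterS _ _ (ae_filter_ringOfSetsType mu)). Qed.

Lemma innerL2_eql u v w : L2 u -> L2 v -> L2 w -> eqL2 u v ->
  innerL2 u w = innerL2 v w.
Proof.
move=> uL2 vL2 wL2 uv; congr fine; apply: ae_eq_integral => //.
- by apply/measurable_EFinP/measurable_funM; exact: L2_measurable.
- by apply/measurable_EFinP/measurable_funM; exact: L2_measurable.
- by apply: filterS_ae uv => x uvx Dx; rewrite uvx.
Qed.

Lemma eqL2_sub0 u v : eqL2 (fun x => u x - v x) (cst 0) -> eqL2 u v.
Proof. by apply: filterS_ae => x h Dx; apply/eqP; rewrite -subr_eq0; apply/eqP/h. Qed.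

Lemma continuous_L2 u : {within `[0, pi], continuous u} -> L2 u.
Proof.
move=> uc.
have iu2 : mu.-integrable `[0, pi] (EFin \o (fun x => u x ^+ 2)).
  apply: continuous_compact_integrable; first exact: segment_compact.
  by move=> x; apply: continuousM; exact: uc.
have Dsub : D `<=` `[0, pi] by exact: subset_itv_oo_cc.
apply/L2P; split; last exact: integrableS iu2.
apply: (@measurable_funS _ _ _ _ `[0, pi]) => //.
by apply: subspace_continuous_measurable_fun.
Qed.

End L2_space.

#[export] Hint Resolve measurable_dom0pi : core.

(** * Lower triangular systems on square-summable sequences *)

Section triangular.
Context {R : realType}.
Implicit Types (M W : nat -> nat -> R) (b c x y : nat -> R).

Definition sqsum (N : nat) c : R := \sum_(0 <= n < N) c n ^+ 2.

Lemma sqsum_ge0 N c : 0 <= sqsum N c.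
Proof. by apply: sumr_ge0 => n _; rewrite sqr_ge0. Qed.

Lemma le_sqsum N N' c : (N <= N')%N -> sqsum N c <= sqsum N' c.
Proof.
move=> NN'; rewrite /sqsum [leRHS](big_cat_nat (n:=N))//= lerDl.
by apply: sumr_ge0 => n _; rewrite sqr_ge0.
Qed.

Lemma weighted_cauchy_schwarz (N : nat) (w x : nat -> R) :
  (forall n, 0 <= w n) ->
  (\sum_(0 <= n < N) w n * x n) ^+ 2 <=
  (\sum_(0 <= n < N) w n) * \sum_(0 <= n < N) w n * x n ^+ 2.
Proof.
move=> w0; elim: N => [|N ih]; first by rewrite !big_geq// expr0n mulr0.
rewrite !big_nat_recr//=.
set A := \sum_(_ <= _ < _) _ in ih *; set S := \sum_(_ <= _ < _) _ in ih *.
set B := \sum_(_ <= _ < _) _ in ih *.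
have S0 : 0 <= S by exact: sumr_ge0.
have B0 : 0 <= B by apply: sumr_ge0 => n _; rewrite mulr_ge0// sqr_ge0.
have wN := w0 N.
(* By induction A^2 <= S B, so the quadratic S X^2 - 2 A X + B has nonpositive discriminant; if S =
   0 it degenerates, but then A = 0 too. *)
have cross : 2 * A * x N <= B + S * x N ^+ 2.
  have [S1|S1] := eqVneq S 0.
    have A0 : A = 0.
      apply/eqP; rewrite -sqrf_eq0 eq_le sqr_ge0 andbT.
      by rewrite (le_trans ih)// S1 mul0r.
    by rewrite A0 S1 mulr0 !mul0r addr0.
  have {S1}S0 : 0 < S by rewrite lt_def S1.
  rewrite -subr_ge0 -(pmulr_rge0 _ S0).
  have -> : S * (B + S * x N ^+ 2 - 2 * A * x N) =
    (S * B - A ^+ 2) + (A - S * x N) ^+ 2 by ring.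
  by rewrite addr_ge0 ?sqr_ge0// subr_ge0.
rewrite -subr_ge0.
have -> : (S + w N) * (B + w N * x N ^+ 2) - (A + w N * x N) ^+ 2 =
  (S * B - A ^+ 2) + w N * (B + S * x N ^+ 2 - 2 * A * x N) by ring.
by rewrite addr_ge0 ?mulr_ge0 ?subr_ge0.
Qed.

(** Cauchy-Schwarz with weights W j n uses up the row sums; exchanging the two summations then
    leaves the column sums. *)
Lemma schur_test (N : nat) W (q : R) x : (forall j n, 0 <= W j n) ->
  (forall j, \sum_(0 <= n < N) W j n <= q) ->
  (forall n, \sum_(0 <= j < N) W j n <= q) ->
  sqsum N (fun j => \sum_(0 <= n < N) W j n * x n) <= q ^+ 2 * sqsum N x.
Proof.
move=> W0 Wrow Wcol.
have q0 : 0 <= q by rewrite (le_trans _ (Wrow 0%N))// sumr_ge0.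
apply: (@le_trans _ _ (\sum_(0 <= j < N) q * \sum_(0 <= n < N) W j n * x n ^+ 2)).
  apply: ler_sum => j _; apply: le_trans (weighted_cauchy_schwarz _ _ _) _ => //.
  by rewrite ler_wpM2r// sumr_ge0// => n _; rewrite mulr_ge0// sqr_ge0.
rewrite -mulr_sumr expr2 -mulrA ler_wpM2l// exchange_big/= /sqsum mulr_sumr.
by apply: ler_sum => n _; rewrite -mulr_suml ler_wpM2r// sqr_ge0.
Qed.

(** Meant for counting the ones in a row or a column of the dilation of indices by some k. *)
Lemma sum_uniq_le1 (N : nat) (P : pred nat) :
  (forall i j, P i -> P j -> i = j) -> \sum_(0 <= i < N) (P i)%:R <= 1 :> R.
Proof.
move=> Puniq; elim: N => [|N ih]; first by rewrite big_geq.
rewrite big_nat_recr//=; have [PN|_] := boolP (P N); last by rewrite addr0.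
rewrite big_nat big1 ?add0r// => i /= iN.
by case: (boolP (P i)) => // /Puniq-/(_ _ PN) iE; rewrite iE ltnn in iN.
Qed.

Definition tri M c j : R := \sum_(0 <= n < j.+1) M j n * c n.

Lemma tri_linear M (a : R) x y j :
  tri M (fun n => a * x n + y n) j = a * tri M x j + tri M y j.
Proof.
rewrite /tri mulr_sumr -big_split/=; apply: eq_bigr => n _.
by rewrite mulrDr mulrCA.
Qed.

Definition tri_step M y x j : R :=
  (y j - \sum_(0 <= n < j) M j n * x n) / M j j.

(* The [j]-th value of [tri_step M y x] depends only on the values of [x] below
   [j], so that iteration from any start stabilizes to the solution. *)
Definition tri_inv M y j : R := iter j.+1 (tri_step M y) (fun=> 0) j.

Lemma tri_inv_iter M y j m : (j < m)%N ->
  iter m (tri_step M y) (fun=> 0) j = tri_inv M y j.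
Proof.
elim/ltn_ind: j m => j ih [//|m] jm; rewrite /tri_inv/= /tri_step.
congr (_ / _); congr (_ - _); apply: eq_big_nat => n /= nj.
by rewrite ih ?(leq_trans nj)// (ih _ nj j).
Qed.

Lemma tri_invE M y j : M j j != 0 -> tri M (tri_inv M y) j = y j.
Proof.
move=> Mj; rewrite /tri big_nat_recr//= {2}/tri_inv/= {2}/tri_step mulrC divfK//.
rewrite -[RHS](subrK (\sum_(0 <= n < j) M j n * tri_inv M y n)) addrC.
congr (_ - _ + _); apply: eq_big_nat => n /= nj.
by rewrite tri_inv_iter.
Qed.

Lemma tri_inj M x y : (forall j, M j j != 0) -> tri M x =1 tri M y -> x =1 y.
Proof.
move=> M0 xy; elim/ltn_ind => j ih; apply: (mulfI (M0 j)).
have := xy j; rewrite /tri !big_nat_recr//= => /eqP; rewrite eq_sym.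
rewrite (_ : \sum_(0 <= n < j) M j n * y n = \sum_(0 <= n < j) M j n * x n).
  by move=> /eqP/addrI.
by apply: eq_big_nat => n /= /ih ->.
Qed.

Lemma tri_invK M x j : (forall j, M j j != 0) -> tri_inv M (tri M x) j = x j.
Proof. by move=> M0; apply: (tri_inj M0) => k; rewrite tri_invE. Qed.

Lemma tri_inv_linear M (a : R) x y j : (forall j, M j j != 0) ->
  tri_inv M (fun n => a * x n + y n) j = a * tri_inv M x j + tri_inv M y j.
Proof.
move=> M0.
rewrite -[RHS](tri_invK (fun n => a * tri_inv M x n + tri_inv M y n) j M0).
congr (tri_inv M _ j); apply/funext => n.
by rewrite tri_linear !tri_invE.
Qed.

(** * Bounds for matrices that are triangular for divisibility *)

Section bounds.
Variables (M : nat -> nat -> R) (b : nat -> R) (q a C : R).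
Hypothesis M0 : forall j n, ~~ (n.+1 %| j.+1)%N -> M j n = 0.
Hypothesis Mb : forall j n k, (2 <= k)%N -> (k * n.+1)%N = j.+1 ->
  `|M j n| <= b k * M n n.
Hypothesis b0 : forall k, 0 <= b k.
Hypothesis bq : forall N, \sum_(2 <= k < N) b k <= q.
Hypothesis q0 : 0 < q.
Hypothesis q1 : q < 1.
Hypothesis a0 : 0 < a.
Hypothesis aM : forall n, a <= M n n.
Hypothesis MC : forall n, M n n <= C.

Let Mgt0 n : 0 < M n n. Proof. exact: lt_le_trans (aM n). Qed.

Definition tri_off x j : R := \sum_(0 <= n < j) M j n * x n.

(** Index n stands for the frequency n + 1. Relative to the diagonal entry M n n, the entry at (j,
    n) is at most b k if j + 1 = k (n + 1) with k >= 2, and zero if n + 1 does not divide j + 1. For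
    fixed k, each row and each column contains at most one such entry, so Schur's test applies with
    the sum of the b k. *)
Lemma tri_off_bound N c :
  sqsum N (tri_off c) <= q ^+ 2 * sqsum N (fun n => M n n * c n).
Proof.
(* A quotient k of j + 1 with j < N is at most N, so this range of k misses no entry. *)
pose W j n : R := \sum_(2 <= k < N.+2) (k * n.+1 == j.+1)%N%:R * b k.
have W0 j n : 0 <= W j n by apply: sumr_ge0 => k _; rewrite mulr_ge0.
have Wrow j : \sum_(0 <= n < N) W j n <= q.
  rewrite exchange_big/=; apply: le_trans (bq N.+2).
  rewrite big_nat [leRHS]big_nat; apply: ler_sum => k /andP[k2 _].
  rewrite -mulr_suml ler_piMl// sum_uniq_le1// => i i' /eqP ki /eqP.
  by rewrite -ki => /eqP; rewrite eqn_mul2l gtn_eqF ?(ltnW k2)//= eqSS => /eqP.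
have Wcol n : \sum_(0 <= j < N) W j n <= q.
  rewrite exchange_big/=; apply: le_trans (bq N.+2).
  rewrite big_nat [leRHS]big_nat; apply: ler_sum => k /andP[k2 _].
  rewrite -mulr_suml ler_piMl// sum_uniq_le1// => i i' /eqP ki /eqP.
  by rewrite ki => -[].
apply: (@le_trans _ _ (sqsum N (fun j => \sum_(0 <= n < N) W j n * `|M n n * c n|))).
  rewrite /sqsum big_nat [leRHS]big_nat; apply: ler_sum => j /= jN.
  rewrite -real_normK ?num_real// lerXn2r ?nnegrE//.
    by apply: sumr_ge0 => n _; rewrite mulr_ge0.
  rewrite (le_trans (ler_norm_sum _ _ _))//.
  rewrite [leRHS](big_cat_nat (n:=j))//= ?(ltnW jN)// ler_wpDr//.
    by apply: sumr_ge0 => n _; rewrite mulr_ge0.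
  rewrite big_nat [leRHS]big_nat; apply: ler_sum => n /= nj.
  rewrite !normrM mulrA ler_wpM2r// [`|M n n|]gtr0_norm//.
  have [/dvdnP[k kn]|/M0 ->] := boolP (n.+1 %| j.+1)%N; last first.
    by rewrite normr0 mulr_ge0// ltW.
  have k2 : (2 <= k)%N.
    case: k kn => [|[|k]]//; rewrite mul1n => -[jn].
    by rewrite jn ltnn in nj.
  have kN : (k < N.+2)%N.
    by rewrite ltnS (leq_trans (leq_pmulr k (ltn0Sn n)))// -kn ltnW.
  apply: le_trans (Mb k2 (esym kn)) _; rewrite ler_wpM2r ?(ltW (Mgt0 n))//.
  rewrite /W (bigD1_seq k) ?iota_uniq ?mem_index_iota ?k2//=.
  rewrite kn eqxx mul1r. rewrite lerDl; apply: sumr_ge0 => i _.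
  by rewrite mulr_ge0.
apply: le_trans (schur_test (fun n => `|M n n * c n|) W0 Wrow Wcol) _.
rewrite ler_wpM2l ?sqr_ge0// /sqsum; apply: ler_sum => n _.
by rewrite real_normK ?num_real.
Qed.

Lemma triE c j : tri M c j = M j j * c j + tri_off c j.
Proof. by rewrite /tri big_nat_recr//= addrC. Qed.

(** Since (x + y)^2 <= 2 x^2 + 2 y^2 and q < 1, the off-diagonal part costs no more than the
    diagonal, whence the factor 4. *)
Lemma tri_bound N c : sqsum N (tri M c) <= 4 * C ^+ 2 * sqsum N c.
Proof.
apply: (@le_trans _ _ (2 * sqsum N (fun n => M n n * c n) + 2 * sqsum N (tri_off c))).
  rewrite /sqsum !mulr_sumr -big_split/=; apply: ler_sum => j _.
  by rewrite triE; have := sqr_ge0 (M j j * c j - tri_off c j); nra.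
apply: (@le_trans _ _ (4 * sqsum N (fun n => M n n * c n))).
  have := tri_off_bound N c; have := sqsum_ge0 N (fun n => M n n * c n).
  by have : q ^+ 2 <= 1 by [rewrite expr_le1// ltW]; nra.
rewrite -mulrA ler_wpM2l// /sqsum mulr_sumr; apply: ler_sum => n _.
rewrite exprMn ler_wpM2r ?sqr_ge0// lerXn2r ?nnegrE ?(ltW (Mgt0 n))//.
exact: le_trans (ltW (Mgt0 n)) (MC n).
Qed.

Lemma tri_lower_bound N c : sqsum N c <= (a * (1 - q)) ^- 2 * sqsum N (tri M c).
Proof.
have q1' : 0 < 1 - q by rewrite subr_gt0.
set S := sqsum N (fun n => M n n * c n).
have aS : a ^+ 2 * sqsum N c <= S.
  rewrite /S /sqsum mulr_sumr; apply: ler_sum => n _.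
  by rewrite exprMn ler_wpM2r ?sqr_ge0// lerXn2r ?nnegrE ?(ltW (Mgt0 n)) ?(ltW a0).
(* The reverse triangle inequality without square roots: termwise, right minus left is (q x + y)^2.
   Inserting the bound q^2 S for the off-diagonal part leaves q (1 - q)^2 S on the left. *)
have qS : q * (1 - q) * S <=
    q * sqsum N (tri M c) + (1 - q) * sqsum N (tri_off c).
  rewrite /S /sqsum !mulr_sumr -big_split/=; apply: ler_sum => j _.
  set x := M j j * c j; rewrite triE -/x; set y := tri_off c j.
  by rewrite -subr_ge0; have := sqr_ge0 (q * x + y); nra.
rewrite -ler_pdivrMl ?invr_gt0 ?exprn_gt0 ?mulr_gt0// invrK exprMn mulrAC.
apply: (@le_trans _ _ (S * (1 - q) ^+ 2)); first by rewrite ler_wpM2r ?sqr_ge0.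
rewrite -(ler_pM2l q0); have := tri_off_bound N c; rewrite -/S => h.
have {h} := ler_wpM2l (ltW q1') h; nra.
Qed.

End bounds.
End triangular.

(** * The Riesz-Fischer theorem *)

Section riesz_fischer.
Context {R : realType}.
Implicit Types (u v w g : R -> R).

Notation mu := (@lebesgue_measure R).
Notation D := (@dom0pi R).
Notation integ u := (mu.-integrable D (EFin \o u)).

Lemma EFin_Rintegral u : integ u ->
  (\int[mu]_(x in D) u x)%:E = (\int[mu]_(x in D) (u x)%:E)%E.
Proof. by move=> iu; rewrite /Rintegral fineK//; exact: integrable_fin_num. Qed.

Lemma cvgn_EFin (a : nat -> R) l :
  a @ \oo --> l -> (a k)%:E @[k --> \oo] --> l%:E.
Proof. by move=> al; apply: cvg_EFin => //; exact: nearW. Qed.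

(* Summable [L^1] norms of the increments already give almost everywhere
   convergence; Fatou's lemma then puts the limit in [L^2]. *)
Section fast_cauchy.
Variables (s : nat -> R -> R) (K B : R).
Hypothesis sL2 : forall k, L2 (s k).
Hypothesis s_cauchy : forall k,
  \int[mu]_(x in D) `|s k.+1 x - s k x| <= K / 2 ^+ k.
Hypothesis s_bound : forall k, innerL2 (s k) (s k) <= B.

Let G x : \bar R := (\sum_(k <oo) (`|s k.+1 x - s k x|)%:E)%E.

Let w_integ k : integ (fun x => `|s k.+1 x - s k x|).
Proof. exact: integrable_norm (L2_integrable (L2B (sL2 _) (sL2 _))). Qed.

Let G_ge0 x : (0 <= G x)%E.
Proof. by apply: nneseries_ge0 => k _ _; rewrite lee_fin. Qed.

Let G_integrable : mu.-integrable D G.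
Proof.
have K0 : 0 <= K.
  by have := s_cauchy 0; rewrite expr0 divr1; apply: le_trans; exact: Rintegral_ge0.
apply/integrableP; split.
  apply: ge0_emeasurable_sum => [k x _ _|k _]; first by rewrite lee_fin.
  exact: measurable_int (w_integ k).
under eq_integral do rewrite gee0_abs//.
rewrite integral_nneseries//; last by move=> k; exact: measurable_int (w_integ k).
apply: (@le_lt_trans _ _ (2 * K)%:E); last exact: ltry.
apply: lime_le.
  by apply: is_cvg_nneseries => k _ _; apply: integral_ge0.
apply: nearW => n.
apply: (@le_trans _ _ (\sum_(0 <= k < n) (K / 2 ^+ k)%:E)%E).
  by apply: lee_sum => k _; rewrite -EFin_Rintegral ?lee_fin ?s_cauchy.
rewrite sumEFin lee_fin -mulr_sumr mulrC ler_wpM2r//.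
suff -> : \sum_(0 <= k < n) (2 ^+ k)^-1 = 2 - 2 * (2 ^+ n)^-1 :> R.
  by rewrite lerBlDr lerDl mulr_ge0// invr_ge0 exprn_ge0.
elim: n => [|n ih]; first by rewrite big_geq// expr0 invr1 mulr1 subrr.
by rewrite big_nat_recr//= ih exprS invfM; field.
Qed.

(** An upper limit is measurable whether or not the sequence converges, and it is the limit wherever
    [G] is finite. *)
Let u x := fine (limn_esup (fun k => (s k x)%:E)).

Let dominated x k : (`|s k x|%:E <= `|s 0%N x|%:E + G x)%E.
Proof.
apply: (@le_trans _ _ (`|s 0%N x| + \sum_(0 <= i < k) `|s i.+1 x - s i x|)%:E).
  rewrite lee_fin -lerBlDl (le_trans (lerB_dist _ _))//.
  by rewrite -(telescope_sumr (s ^~ x) (leq0n k)) ler_norm_sum.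
by rewrite EFinD leeD2l// -sumEFin; apply: nneseries_lim_ge.
Qed.

Let s_cvg x : G x \is a fin_num -> s ^~ x @ \oo --> u x.
Proof.
move=> Gx.
have : cvgn (series (fun k => s k.+1 x - s k x)).
  apply: normed_cvg; apply: nondecreasing_is_cvgn.
    exact: (@nondecreasing_series R (fun k => `|s k.+1 x - s k x|) xpredT 0).
  exists (fine (G x)) => _ [n _ <-]; rewrite -lee_fin fineK// /series/= -sumEFin.
  exact: nneseries_lim_ge.
rewrite /series/=; under eq_fun do rewrite (telescope_sumr (s ^~ x))//.
move=> /cvg_ex[/= l sl].
have {}sl : s ^~ x @ \oo --> l + s 0%N x.
  by under eq_fun do rewrite -(subrK (s 0%N x) (s _ x)); exact: cvgD sl (cvg_cst _).
by rewrite /u (cvg_limn_einf_sup (cvgn_EFin sl)).2.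
Qed.

Let good : \forall x \ae mu, D x -> G x \is a fin_num.
Proof. exact: integrable_ae. Qed.

Let u_measurable : measurable_fun D u.
Proof.
apply: measurableT_comp => //; apply: measurable_fun_limn_esup => k.
by apply/measurable_EFinP; exact: L2_measurable.
Qed.

Let sqr_int k : (\int[mu]_(x in D) (s k x ^+ 2)%:E = (innerL2 (s k) (s k))%:E)%E.
Proof. by rewrite EFin_Rintegral//; exact: L2_integrableM. Qed.

Let u_int : (\int[mu]_(x in D) (u x ^+ 2)%:E <= B%:E)%E.
Proof.
apply: (@le_trans _ _ (\int[mu]_(x in D) limn_einf (fun k => (s k x ^+ 2)%:E))%E).
  rewrite le_eqVlt; apply/orP; left; apply/eqP/ae_eq_integral => //.
  - by apply/measurable_EFinP; exact: measurable_funX.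
  - rewrite (_ : (fun _ => _) =
      (fun x => - limn_esup (fun k => - (s k x ^+ 2)%:E))%E).
      apply: measurableT_comp => //; apply: measurable_fun_limn_esup => k.
      apply: measurableT_comp => //.
      by apply/measurable_EFinP/measurable_funX; exact: L2_measurable.
    apply/funext => x; rewrite -limn_einfN; congr limn_einf.
    by apply/funext => k; exact/esym/oppeK.
  move: good; apply: filterS_ae => x xG /xG/s_cvg sx; apply/esym.
  by rewrite (cvg_limn_einf_sup (cvgn_EFin (cvgM sx sx))).1.
apply: le_trans (fatou _ _ _ _) _ => //.
- by move=> k; apply/measurable_EFinP/measurable_funX; exact: L2_measurable.
- by move=> k x _; rewrite lee_fin sqr_ge0.
rewrite limn_einf_lim; apply: lime_le; first exact: is_cvg_einfs.
apply: nearW => n; apply: (@le_trans _ _ (\int[mu]_(x in D) (s n x ^+ 2)%:E)%E).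
  by apply: ereal_inf_lbound; exists n => /=.
by rewrite sqr_int lee_fin.
Qed.

(** Testing against bounded g is enough, since the basis functions will be bounded; it allows
    dominated convergence with the majorant M (|s 0| + G). *)
Lemma L2_fast_cauchy_cvg : exists u, [/\ L2 u, innerL2 u u <= B &
  forall g M, measurable_fun D g -> (forall x, D x -> `|g x| <= M) ->
    innerL2 (s k) g @[k --> \oo] --> innerL2 u g].
Proof.
have uL2 : L2 u.
  apply/L2P; split=> //; apply/integrableP; split.
    by apply/measurable_EFinP; exact: measurable_funX.
  under eq_integral do rewrite /= ger0_norm ?sqr_ge0//.
  exact: le_lt_trans u_int (ltry _).
exists u; split=> // [|g M mg gM].
  by rewrite -lee_fin EFin_Rintegral//; exact: L2_integrableM.
have gL2 := L2_bounded mg gM.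
have := @dominated_convergence _ _ _ mu D measurable_dom0pi
  (fun k x => (s k x * g x)%:E) (fun x => (u x * g x)%:E)
  (fun x => M%:E * (`|s 0%N x|%:E + G x))%E.
case.
- by move=> k; apply/measurable_EFinP/measurable_funM => //; exact: L2_measurable.
- by apply/measurable_EFinP; exact: measurable_funM.
- move: good; apply: filterS_ae => x xG /xG/s_cvg sx.
  by apply: cvgn_EFin; apply: cvgM => //; exact: cvg_cst.
- apply: integrableZl => //; apply: integrableD => //.
  exact: integrable_norm (L2_integrable (sL2 0)).
- apply/aeW => x k Dx; rewrite abse_EFin normrM EFinM muleC.
  by rewrite lee_pmul// lee_fin gM.
move=> _ _; rewrite -(EFin_Rintegral (L2_integrableM uL2 gL2)).
by move/fine_cvg.
Qed.

End fast_cauchy.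
End riesz_fischer.

(** * Bounded orthonormal systems: Bessel's inequality and Riesz-Fischer *)

Section orthonormal_system.
Context {R : realType}.
Implicit Types (u v w g : R -> R) (c : nat -> R).

Notation mu := (@lebesgue_measure R).
Notation D := (@dom0pi R).

Lemma sqsum_cauchy c (B : R) : (forall N, sqsum N c <= B) ->
  forall e : R, 0 < e -> exists N0, forall N, sqsum N c <= sqsum N0 c + e.
Proof.
move=> cB e e0; pose A := range (fun N => sqsum N c).
have supA : has_sup A.
  by split; [exists (sqsum 0 c), 0%N|exists B => _ [N _ <-]; exact: cB].
have [_ [N0 _ <-] h] := sup_adherent e0 supA.
exists N0 => N; apply: (@le_trans _ _ (sup A)).
  by apply: ub_le_sup; [exact: supA.2|exists N].
by rewrite -lerBlDr ltW.
Qed.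

(** A tail 4^-k of the squares is what makes the L^1 norms of the increments of size 2^-k. *)
Lemma fast_subsequence c (B : R) : (forall N, sqsum N c <= B) ->
  exists phi : nat -> nat, [/\ forall k, (phi k <= phi k.+1)%N,
    forall k, (k <= phi k)%N &
    forall k N, sqsum N c <= sqsum (phi k) c + (4 ^+ k)^-1].
Proof.
move=> cB.
have /choice[psi psiP] k : exists N0, forall N, sqsum N c <= sqsum N0 c + (4 ^+ k)^-1.
  by apply: (sqsum_cauchy cB); rewrite invr_gt0 exprn_gt0.
(* Summing the psi i makes the indices monotone and adding k makes them unbounded; enlarging an
   index only improves its tail bound. *)
exists (fun k => k + \sum_(0 <= i < k.+1) psi i)%N; split=> [k|k|k N].
- by rewrite [in leqRHS]big_nat_recr//= addnA (leq_trans _ (leq_addr _ _))// leq_add2r.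
- exact: leq_addr.
- apply: le_trans (psiP k N) _; rewrite lerD2r le_sqsum// big_nat_recr//=.
  by rewrite addnA leq_addl.
Qed.

Variables (e : nat -> R -> R) (M : R).
Hypothesis e_measurable : forall n, measurable_fun D (e n).
Hypothesis e_bounded : forall n x, D x -> `|e n x| <= M.
Hypothesis e_orthonormal : Defs.orthonormal e.

Let eL2 n : L2 (e n). Proof. exact: L2_bounded (e_measurable n) (@e_bounded n). Qed.

Definition coef u n : R := innerL2 u (e n).

Definition psum c (m N : nat) x : R := \sum_(m <= n < N) c n * e n x.

Lemma psum_L2 c m N : L2 (psum c m N).
Proof. by apply: L2_sum => n; exact: L2Zl. Qed.

Lemma inner_psum c m N v : L2 v ->
  innerL2 (psum c m N) v = \sum_(m <= n < N) c n * innerL2 (e n) v.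
Proof.
move=> vL2; rewrite innerL2_suml// => [|n]; last exact: L2Zl.
by apply: eq_bigr => n _; rewrite innerL2Zl.
Qed.

Lemma coef_psum c N n : coef (psum c 0 N) n = (n < N)%N%:R * c n.
Proof.
rewrite /coef inner_psum//; under eq_bigr do rewrite e_orthonormal.
have [nN|nN] := ltnP n N; last first.
  rewrite mul0r big_nat big1// => i /andP[_ iN].
  by rewrite ltn_eqF ?mulr0// (leq_trans iN).
rewrite (bigD1_seq n) ?iota_uniq ?mem_index_iota//= eqxx mulr1 mul1r big1 ?addr0//.
by move=> i /negbTE ->; rewrite mulr0.
Qed.

Lemma inner_psum_self c m N :
  innerL2 (psum c m N) (psum c m N) = \sum_(m <= n < N) c n ^+ 2.
Proof.
rewrite inner_psum; last exact: psum_L2.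
rewrite big_nat [RHS]big_nat; apply: eq_bigr => n mnN.
rewrite innerL2C inner_psum//; under eq_bigr do rewrite e_orthonormal.
rewrite (bigD1_seq n) ?iota_uniq ?mem_index_iota//= eqxx mulr1 big1 ?addr0//.
by move=> i /negbTE ->; rewrite mulr0.
Qed.

Lemma inner_sub_psum u N : L2 u ->
  innerL2 (fun x => u x - psum (coef u) 0 N x) (fun x => u x - psum (coef u) 0 N x)
  = innerL2 u u - sqsum N (coef u).
Proof.
move=> uL2; have pL2 := psum_L2 (coef u) 0 N; have upL2 := L2B uL2 pL2.
have up : innerL2 (psum (coef u) 0 N) u = sqsum N (coef u).
  rewrite inner_psum//; apply: eq_bigr => n _.
  by rewrite innerL2C expr2.
rewrite innerL2Bl// !innerL2Br// inner_psum_self -/(sqsum N _).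
by rewrite [innerL2 u (psum _ _ _)]innerL2C up subrr subr0.
Qed.

Lemma bessel u N : L2 u -> sqsum N (coef u) <= innerL2 u u.
Proof. by move=> uL2; rewrite -subr_ge0 -inner_sub_psum// innerL2_ge0. Qed.

Lemma L1_le_L2 w (k : nat) : L2 w -> innerL2 w w <= (4 ^+ k)^-1 ->
  \int[mu]_(x in D) `|w x| <= (1 + pi) / 2 ^+ k.
Proof.
move=> wL2 wk.
have k0 : 0 < 2 ^+ k :> R by rewrite exprn_gt0.
have k4 : (4 ^+ k) = (2 ^+ k) * (2 ^+ k) :> R by rewrite -exprMn; congr (_ ^+ _); ring.
have iw2 := L2_integrableM wL2 wL2; have i1 := L2_integrable (@L2_cst R (2 ^- k)).
have izw : mu.-integrable D (EFin \o (fun x => 2 ^+ k * (w x * w x))).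
  by have := integrableZl measurable_dom0pi (2 ^+ k) iw2; exact: eq_integrable.
(* Pointwise |w| <= 2^k w^2 + 2^-k by completing a square. Integration gives 2^k 4^-k + pi 2^-k, the
   origin of the constant 1 + pi. *)
apply: (@le_trans _ _ (\int[mu]_(x in D) (2 ^+ k * (w x * w x) + 2 ^- k))).
  apply: le_Rintegral => //.
  - exact: integrable_norm (L2_integrable wL2).
  - by have := integrableD measurable_dom0pi izw i1; exact: eq_integrable.
  move=> x _; rewrite -(ler_pM2l k0) mulrDr mulfV ?gt_eqF//.
  rewrite -expr2 -real_normK ?num_real//.
  by set a := 2 ^+ k; have := sqr_ge0 (a * `|w x| - 1); have := sqr_ge0 (a * `|w x|); nra.
rewrite RintegralD// RintegralZl// Rintegral_cst//.
rewrite [X in fine X]lebesgue_dom0pi/= mulrDl [pi * _]mulrC lerD2r mul1r.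
by rewrite -(ler_pM2l k0) mulfV ?gt_eqF// mulrA -k4 mulrC -ler_pdivlMr ?mul1r// exprn_gt0.
Qed.

(** The last clause passes an orthogonality relation shared by all [e n] to the limit; with g =
    [phi0] it will put u into [L2perp]. *)
Lemma riesz_fischer c (B : R) : (forall N, sqsum N c <= B) ->
  exists u, [/\ L2 u, innerL2 u u <= B, forall n, coef u n = c n &
    forall g C, measurable_fun D g -> (forall x, D x -> `|g x| <= C) ->
      (forall n, innerL2 (e n) g = 0) -> innerL2 u g = 0].
Proof.
move=> cB; have [phi [phiS phik phic]] := fast_subsequence cB.
pose s k := psum c 0 (phi k).
have [k|k|k|u [uL2 uB su]] := @L2_fast_cauchy_cvg R s (1 + pi) B.
- exact: psum_L2.
- rewrite (_ : (fun _ => _) = (fun x => `|psum c (phi k) (phi k.+1) x|)).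
    apply: L1_le_L2; first exact: psum_L2.
    rewrite inner_psum_self; have := phic k (phi k.+1).
    by rewrite /sqsum (big_cat_nat (n := phi k))//= lerD2l.
  apply/funext => x; congr (`|_|).
  by rewrite /s /psum [in LHS](big_cat_nat (n := phi k))//= addrAC subrr add0r.
- by rewrite inner_psum_self; exact: cB.
exists u; split=> // [n|g C mg gC eg].
- rewrite /coef; have /= := su (e n) M (e_measurable n) (@e_bounded n).
  move=> /cvg_lim <-//; apply: lim_near_cst => //.
  exists n.+1 => // k /= nk; rewrite -[innerL2 _ _]/(coef (s k) n) coef_psum.
  by rewrite (leq_trans nk (phik k)) mul1r.
- have /= := su g C mg gC => /cvg_lim <-//; apply: lim_near_cst => //.
  apply: nearW => k; rewrite inner_psum; last exact: L2_bounded mg gC.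
  by rewrite big1// => n _; rewrite eg mulr0.
Qed.

End orthonormal_system.

(** * Completeness of the cosines *)

Section cosine_uniqueness.
Context {R : realType}.
Implicit Types (u v w : R -> R).

Notation mu := (@lebesgue_measure R).
Notation D := (@dom0pi R).

Lemma mulr_cos (x y : R) : 2 * (cos x * cos y) = cos (x + y) + cos (x - y).
Proof. by rewrite cosD cosB; ring. Qed.

Lemma onem_exp_le (t : R) (n : nat) : 0 <= t <= 1 -> (1 - t) ^+ n * (1 + n%:R * t) <= 1.
Proof.
move=> /andP[t0 t1]; elim: n => [|n ih]; first by rewrite expr0 mul0r addr0 mul1r.
rewrite exprSr -mulrA; apply: le_trans ih.
rewrite ler_wpM2l ?exprn_ge0 ?subr_ge0//.
by rewrite -natr1; have : 0 <= n%:R :> R by []; nra.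
Qed.

Lemma onem_exp_ge (t : R) (n : nat) : 0 <= t <= 1 -> 1 - n%:R * t <= (1 - t) ^+ n.
Proof.
move=> /andP[t0 t1]; elim: n => [|n ih]; first by rewrite expr0 mul0r subr0.
have : 0 <= n%:R :> R by []; rewrite exprS -natr1.
have := ler_wpM2l (_ : 0 <= 1 - t) ih; rewrite subr_ge0 => /(_ t1); nra.
Qed.

(* The polynomials (1 - y^n)^(2^n) converge boundedly on [0, 1] to the indicator
   function of [0, 1/2[ away from y = 1/2, by Bernoulli's inequality. *)
Lemma onem_exp_exp2_cvg1 (y : R) : 0 <= y < 2^-1 ->
  (1 - y ^+ n) ^+ (2 ^ n) @[n --> \oo] --> (1 : R).
Proof.
move=> /andP[y0 y2].
have cvg2y : 1 - (2 * y) ^+ n @[n --> \oo] --> (1 : R).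
  rewrite -[X in _ --> X]subr0; apply: cvgB; first exact: cvg_cst.
  by apply: cvg_expr; rewrite ger0_norm ?mulr_ge0//; lra.
apply: squeeze_cvgr; [|exact: cvg2y|exact: cvg_cst]; apply: nearW => n.
have yn : 0 <= y ^+ n <= 1 by rewrite exprn_ge0//= exprn_ile1//; lra.
apply/andP; split; last by rewrite exprn_ile1//; lra.
by apply: le_trans (onem_exp_ge _ yn); rewrite natrX exprMn.
Qed.

Lemma onem_exp_exp2_cvg0 (y : R) : 2^-1 < y <= 1 ->
  (1 - y ^+ n) ^+ (2 ^ n) @[n --> \oo] --> (0 : R).
Proof.
move=> /andP[y2 y1].
have cvg2y : (2 * y)^-1 ^+ n @[n --> \oo] --> (0 : R).
  apply: cvg_expr; rewrite ger0_norm ?invr_ge0 ?mulr_ge0//; last by lra.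
  by rewrite invf_lt1; lra.
apply: (@squeeze_cvgr _ _ _ _ (fun=> 0)); [|exact: cvg_cst|exact: cvg2y]; apply: nearW => n.
have y0 : 0 < y by lra.
have yn : 0 <= y ^+ n <= 1 by rewrite exprn_ge0 ?exprn_ile1 ?(ltW y0).
apply/andP; split; first by rewrite exprn_ge0//; lra.
have h := onem_exp_le (2 ^ n) yn.
have p0 : 0 < (2 * y) ^+ n by rewrite exprn_gt0 ?mulr_gt0.
rewrite exprVn -(ler_pM2r p0) mulVf ?gt_eqF//; apply: le_trans h.
rewrite ler_wpM2l//; first by rewrite exprn_ge0//; lra.
by rewrite natrX exprMn lerDr.
Qed.

Lemma continuous_cosM (a : R) : continuous (fun x : R => cos (a * x)).
Proof.
move=> x; apply: (@continuous_comp _ _ _ (fun x => a * x) cos).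
  by apply: cvgM; [exact: cvg_cst|exact: cvg_id].
exact: continuous_cos.
Qed.

Lemma L2_cosM (a : R) : L2 (fun x : R => cos (a * x)).
Proof. exact/continuous_L2/continuous_subspaceT/continuous_cosM. Qed.

Lemma continuous_L2T u : continuous u -> L2 u.
Proof. by move=> uc; exact/continuous_L2/continuous_subspaceT. Qed.

Lemma continuous_horner_cos (p : {poly R}) : continuous (fun x : R => p.[cos x]).
Proof.
move=> x; apply: (@continuous_comp _ _ _ cos (horner p)).
  exact: continuous_cos.
exact: continuous_horner.
Qed.

Lemma continuous_cosX (m : nat) : continuous (fun x : R => cos x ^+ m).
Proof.
move=> x; apply: (@continuous_comp _ _ _ cos (fun z => z ^+ m)).
  exact: continuous_cos.
exact: exprn_continuous.
Qed.

Section orthogonal.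
Variable v : R -> R.
Hypothesis vL2 : L2 v.
Hypothesis v_cos : forall j : nat, innerL2 v (fun x => cos (j%:R * x)) = 0.

(** Only the powers of cos are wanted. The extra factor cos(k x) serves the induction on m: the
    product formula trades one power of cos x for the neighbouring frequencies. *)
Let v_cosX m : forall k : nat,
  innerL2 v (fun x => cos x ^+ m * cos (k%:R * x)) = 0.
Proof.
have L2m n k : L2 (fun x : R => cos x ^+ n * cos (k%:R * x)).
  apply: continuous_L2T => x; apply: cvgM; last exact: continuous_cosM.
  exact: continuous_cosX.
elim: m => [|m ih] k.
  by under eq_fun do rewrite expr0 mul1r; exact: v_cos.
case: k => [|n].
  rewrite -(ih 1%N); congr innerL2; apply/funext => x.
  by rewrite mul0r mul1r cos0 mulr1 exprSr.
have -> : (fun x : R => cos x ^+ m.+1 * cos (n.+1%:R * x)) =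
  (fun x => 2^-1 * (cos x ^+ m * cos (n.+2%:R * x) + cos x ^+ m * cos (n%:R * x))).
  apply/funext => x; rewrite -mulrDr exprSr [RHS]mulrCA -mulrA; congr (_ * _).
  have := mulr_cos (n.+1%:R * x) x.
  have -> : n.+1%:R * x + x = n.+2%:R * x by rewrite -(natr1 n.+1); ring.
  have -> : n.+1%:R * x - x = n%:R * x by rewrite -(natr1 n); ring.
  by move=> <-; field.
by rewrite innerL2Zr ?innerL2Dr ?ih ?addr0 ?mulr0//; exact: L2D.
Qed.

Let v_poly (p : {poly R}) : innerL2 v (fun x => p.[cos x]) = 0.
Proof.
under eq_fun do rewrite horner_coef.
rewrite innerL2C innerL2_suml// => [|i]; last first.
  exact/L2Zl/continuous_L2T/continuous_cosX.
rewrite big1// => i _; rewrite innerL2Zl//; last first.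
  exact/continuous_L2T/continuous_cosX.
rewrite innerL2C -[RHS](mulr0 p`_i) -(v_cosX i 0); congr (_ * innerL2 _ _).
by apply/funext => x; rewrite mul0r cos0 mulr1.
Qed.

Let v_indic (a : R) : 0 < a < pi ->
  \int[mu]_(x in D) (v x * (x <= a)%R%:R) = 0.
Proof.
move=> /andP[a0 api].
(* An affine function of cos x with values in [0, 1]. As cos decreases on [0, pi], y x lies below
   1/2 for x < a and above 1/2 for x > a, so the polynomials [P n] in cos x converge to the
   indicator function off x = a. *)
pose y x : R := 2^-1 + (cos a - cos x) / 4.
have yE x : 0 <= y x <= 1.
  rewrite /y; have := cos_geN1 a; have := cos_le1 a.
  by have := cos_geN1 x; have := cos_le1 x => *; apply/andP; split; lra.
pose P n : {poly R} :=
  (1 - ((2^-1 + cos a / 4)%:P - 4^-1 *: 'X) ^+ n) ^+ (2 ^ n).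
have PE n x : (P n).[cos x] = (1 - y x ^+ n) ^+ (2 ^ n).
  rewrite /P !(hornerE, horner_exp) /y.
  by congr ((1 - _ ^+ _) ^+ _); field.
have y01 n x : 0 <= 1 - y x ^+ n <= 1.
  have /andP[y0 y1] := yE x.
  have : 0 <= y x ^+ n <= 1 by rewrite exprn_ge0//= exprn_ile1.
  by move=> /andP[? ?]; apply/andP; split; lra.
have P_cvg x : D x -> x != a -> (P n).[cos x] @[n --> \oo] --> ((x <= a)%R%:R : R).
  rewrite /dom0pi/= in_itv/= => /andP[x0 xpi] xa; under eq_fun do rewrite PE.
  have := @ltr_cos R x a; have := @ltr_cos R a x; rewrite !in_itv/=.
  rewrite (ltW x0) (ltW xpi) (ltW a0) (ltW api) => /(_ isT isT) cax /(_ isT isT) cxa.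
  have /andP[y0 y1] := yE x.
  have [xlea|altx] := leP x a.
    have {xa xlea} : x < a by rewrite lt_neqAle xa.
    by rewrite -cxa => ?; apply: onem_exp_exp2_cvg1; rewrite y0/= /y; lra.
  by move: altx; rewrite -cax => ?; apply: onem_exp_exp2_cvg0; rewrite y1 andbT /y; lra.
have PL2 n : L2 (fun x => (P n).[cos x]) by exact/continuous_L2T/continuous_horner_cos.
have := @dominated_convergence _ _ _ mu D measurable_dom0pi
  (fun n x => (v x * (P n).[cos x])%:E) (fun x : R => (v x * (x <= a)%R%:R)%:E)
  (fun x => `|v x|%:E).
case.
- by move=> n; apply/measurable_EFinP/measurable_funM; exact: L2_measurable.
- apply/measurable_EFinP/measurable_funM; first exact: L2_measurable.
  rewrite (_ : (fun _ => _) = \1_(`]-oo, a]%classic)); first exact: measurable_indic.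
  by apply/funext => x; rewrite indicE/= mem_setE in_itv.
- exists [set a]; split; [exact: measurable_set1|exact: lebesgue_measure_set1|].
  move=> x /= /not_implyP[Dx]; apply: contra_notP => xa.
  apply: cvgn_EFin; apply: cvgM; first exact: cvg_cst.
  by apply: P_cvg => //; apply/eqP.
- exact: integrable_norm (L2_integrable vL2).
- apply/aeW => x n Dx; rewrite abse_EFin lee_fin normrM ler_piMr//.
  rewrite PE ger0_norm; have /andP[? ?] := y01 n x; last by rewrite exprn_ge0.
  by rewrite exprn_ile1.
move=> iv _; rewrite -(@EFin_Rintegral _ (fun x => v x * (x <= a)%R%:R))//.
move=> /fine_cvg/cvg_lim <-//; apply: lim_near_cst => //.
by apply: nearW => n; exact: v_poly.
Qed.

(** By [v_indic] the primitive of v vanishes on the whole interval, and by Lebesgue's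
    differentiation theorem its derivative is v almost everywhere. *)
Lemma eqL2_0_of_cos : eqL2 v (cst 0).
Proof.
have iv : mu.-integrable setT (EFin \o (v \_ D)).
  rewrite -restrict_EFin.
  exact: (proj1 (@integrable_mkcond _ _ _ mu D _ measurable_dom0pi) (L2_integrable vL2)).
pose F x := \int[mu]_(t in `]-oo, x]) (v \_ D) t.
have F0 y : D y -> F y = 0.
  rewrite /dom0pi/= in_itv/= => /v_indic <-.
  rewrite /F Rintegral_mkcond [RHS]Rintegral_mkcond; congr Rintegral.
  apply/funext => x; rewrite !patchE mem_setE in_itv/=.
  by case: (x <= y); case: (x \in D); rewrite ?mulr1 ?mulr0.
have := @FTC1Ny R (v \_ D).
case.
- by move=> y; exact: integrableS iv.
- exact: open_integrable_locally openT iv.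
move=> N [mN N0 subN]; exists N; split=> // x /= vx; apply: subN => /= -[_].
apply: contra_not vx => vx Dx; move: vx; rewrite patchE mem_set// => <-.
rewrite derive1E; transitivity ('D_1 (cst (0 : R)) x); last exact: derive_cst.
apply: near_eq_derive; near=> y; apply: F0; near: y.
by apply: open_nbhs_nbhs; split=> //; exact: interval_open.
Unshelve. all: by end_near. Qed.

End orthogonal.
End cosine_uniqueness.

(** * The cosine basis and the lifting of sequence operators to functions *)

Section cosine_basis.
Context {R : realType}.
Implicit Types (u v w : R -> R) (c : nat -> R).

Notation mu := (@lebesgue_measure R).
Notation D := (@dom0pi R).

Lemma continuous_integrable (a b : R) (f : R -> R) : {within `[a, b], continuous f} ->
  mu.-integrable `[a, b] (EFin \o f).
Proof. by move=> fc; apply: continuous_compact_integrable => //; exact: segment_compact. Qed.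

Lemma Rintegral_itv_oo_cc (a b : R) (f : R -> R) :
  mu.-integrable `[a, b] (EFin \o f) ->
  \int[mu]_(x in `]a, b[) f x = \int[mu]_(x in `[a, b]) f x.
Proof.
move=> fi; rewrite Rintegral_itv_bndo_bndc; last first.
  by apply: integrableS fi => //; exact: subset_itv_oo_cc.
rewrite Rintegral_itv_obnd_cbnd//; apply: integrableS fi => //.
exact: subset_itv_oc_cc.
Qed.

Lemma Rintegral_derive (a b : R) (f F : R -> R) : a <= b -> continuous f ->
  (forall x : R, is_derive x 1 F (f x)) -> \int[mu]_(x in `[a, b]) f x = F b - F a.
Proof.
rewrite le_eqVlt => /predU1P[<- _ _|ab fc Ff].
  by rewrite set_itv1 Rintegral_set1 subrr.
have cF : continuous F.
  by move=> x; apply: differentiable_continuous; apply/derivable1_diffP; exact: ex_derive.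
rewrite /Rintegral (@continuous_FTC2 _ _ F)//.
- exact: continuous_subspaceT.
- split=> [x _||]; first exact: ex_derive.
  + exact/cvg_at_right_filter/cF.
  + exact/cvg_at_left_filter/cF.
- by move=> x _; rewrite derive1E derive_val.
Qed.

Lemma is_derive_comp_real (f g : R -> R) (x df dg : R) :
  is_derive (g x) 1 f df -> is_derive x 1 g dg ->
  is_derive x 1 (fun y => f (g y)) (df * dg).
Proof.
move=> [f1 <-] [g1 <-]; apply: DeriveDef.
  apply/derivable1_diffP/(differentiable_comp (f := g)).
    exact/derivable1_diffP.
  exact/derivable1_diffP.
by rewrite -!derive1E derive1_comp.
Qed.

Lemma is_derive_scale (a x d : R) (f : R -> R) :
  is_derive x 1 f d -> is_derive x 1 (fun y => a * f y) (a * d).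
Proof. exact: is_deriveZ. Qed.

Lemma is_derive_mull (a x : R) : is_derive x 1 (fun y => a * y) a.
Proof.
by rewrite -[X in is_derive _ _ _ X]mulr1; apply: is_derive_scale; exact: is_derive_id.
Qed.

Lemma is_derive_sinM (a x : R) : is_derive x 1 (fun y => sin (a * y)) (a * cos (a * x)).
Proof.
rewrite mulrC; apply: is_derive_comp_real; exact: is_derive_mull.
Qed.

Lemma is_derive_cosM (a x : R) : is_derive x 1 (fun y => cos (a * y)) (- a * sin (a * x)).
Proof.
rewrite mulNr -mulrN mulrC; apply: is_derive_comp_real; exact: is_derive_mull.
Qed.

Lemma sin_natmul_pi (j : nat) : sin (j%:R * pi) = 0 :> R.
Proof.
elim: j => [|j ih]; first by rewrite mul0r sin0.
by rewrite -natr1 mulrDl mul1r sinDpi ih oppr0.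
Qed.

Lemma integral_cosM (j : nat) :
  \int[mu]_(x in D) cos (j%:R * x) = (j == 0)%N%:R * pi.
Proof.
have cc : continuous (fun x : R => cos (j%:R * x)) by exact: continuous_cosM.
rewrite Rintegral_itv_oo_cc; last exact/continuous_integrable/continuous_subspaceT.
have [->|j0] := eqVneq j 0.
  under eq_Rintegral do rewrite mul0r cos0.
  rewrite Rintegral_cst// [X in fine X]lebesgue_measure_itv/= lte_fin pi_gt0.
  by rewrite -EFinB subr0.
have j0' : j%:R != 0 :> R by rewrite pnatr_eq0.
have dF (x : R) : is_derive x 1 (fun x => j%:R^-1 * sin (j%:R * x)) (cos (j%:R * x)).
  rewrite -[X in is_derive _ _ _ X](mulKf j0'); apply: is_derive_scale.
  exact: is_derive_sinM.
rewrite (Rintegral_derive (pi_ge0 R) cc dF) mulr0 sin0 mulr0 subr0 mul0r.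
by rewrite sin_natmul_pi mulr0.
Qed.

Lemma innerL2_cos_cos (m n : nat) :
  innerL2 (fun x => cos (m.+1%:R * x)) (fun x => cos (n.+1%:R * x)) =
  (m == n)%:R * (pi / 2) :> R.
Proof.
wlog mn : m n / (n <= m)%N.
  move=> h; have [/h//|/ltnW/h] := leqP n m.
  by rewrite innerL2C eq_sym.
have E (x : R) : cos (m.+1%:R * x) * cos (n.+1%:R * x) =
    2^-1 * (cos ((m.+1 + n.+1)%:R * x) + cos ((m - n)%:R * x)).
  rewrite natrD mulrDl natrB// mulrBl.
  rewrite -[m%:R * x - _](_ : m.+1%:R * x - n.+1%:R * x = _).
    by rewrite -mulr_cos; field.
  by rewrite -(natr1 m) -(natr1 n); ring.
rewrite /innerL2; under eq_Rintegral do rewrite E.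
have i j : mu.-integrable D (EFin \o (fun x : R => cos (j%:R * x))).
  exact/L2_integrable/L2_cosM.
rewrite RintegralZl ?RintegralD ?integral_cosM//; last first.
  exact: L2_integrable (L2D (L2_cosM _) (L2_cosM _)).
rewrite mul0r add0r subn_eq0 mulrCA [2^-1 * _]mulrC; congr (_%:R * _).
by rewrite eqn_leq mn andbT.
Qed.

(** The constant mode is left out, which makes this a basis of [L2perp]; index n carries the
    frequency n + 1. *)
Definition cosbasis (n : nat) (x : R) : R := Num.sqrt (2 / pi) * cos (n.+1%:R * x).

Lemma L2_cosbasis n : L2 (cosbasis n).
Proof. exact/L2Zl/L2_cosM. Qed.

Lemma cosbasis_orthonormal : Defs.orthonormal cosbasis.
Proof.
move=> m n; have ? := L2_cosM (R := R) m.+1%:R; have ? := L2_cosM (R := R) n.+1%:R.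
rewrite /cosbasis innerL2Zl// ?innerL2Zr//; last exact: L2Zl.
rewrite mulrA -expr2 sqr_sqrtr ?divr_ge0 ?pi_ge0// innerL2_cos_cos mulrCA.
have : pi != 0 :> R by rewrite gt_eqF ?pi_gt0.
by move=> p0; rewrite mulf_div [2 * pi]mulrC divff ?mulr1// mulf_neq0.
Qed.

Lemma cosbasis_measurable n : measurable_fun D (cosbasis n).
Proof. by apply: L2_measurable; exact: L2_cosbasis. Qed.

Lemma cosbasis_bounded n x : D x -> `|cosbasis n x| <= Num.sqrt (2 / pi).
Proof.
by move=> _; rewrite normrM ger0_norm ?sqrtr_ge0// ler_piMr ?sqrtr_ge0// cos_max.
Qed.

Lemma innerL2_cosM_cst (n : nat) (a : R) :
  innerL2 (fun x => cos (n.+1%:R * x)) (fun=> a) = 0.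
Proof.
rewrite /innerL2 RintegralZr// ?integral_cosM ?mul0r//.
exact/L2_integrable/L2_cosM.
Qed.

Lemma cosbasis_phi0 n : innerL2 (cosbasis n) phi0 = 0.
Proof.
rewrite /cosbasis innerL2Zl; [|exact: L2_cosM|exact: L2_cst].
by rewrite innerL2_cosM_cst mulr0.
Qed.

Notation coef := (coef cosbasis).

Lemma L2perpP u : L2perp u <-> L2 u /\ \int[mu]_(x in D) u x = 0.
Proof.
have E : L2 u -> innerL2 u phi0 = \int[mu]_(x in D) u x * (Num.sqrt 2 / 2).
  by move=> uL2; rewrite /innerL2 RintegralZr//; exact: L2_integrable.
split=> -[uL2]; first rewrite E// => /eqP; last by rewrite /L2perp/= E// => ->; rewrite mul0r.
rewrite mulf_eq0 [X in _ || X]gt_eqF ?divr_gt0 ?sqrtr_gt0// orbF => /eqP u0.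
by split.
Qed.

Lemma L2perp_L2 u : L2perp u -> L2 u. Proof. by case. Qed.

Lemma L2perp_linear (a : R) u v : L2perp u -> L2perp v ->
  L2perp (fun x => a * u x + v x).
Proof.
move=> [uL2 u0] [vL2 v0]; split; first exact: L2_linear.
by rewrite innerL2_linearl ?u0 ?v0 ?mulr0 ?addr0//; exact: L2_cst.
Qed.

Lemma L2perpB u v : L2perp u -> L2perp v -> L2perp (fun x => u x - v x).
Proof.
move=> [uL2 u0] [vL2 v0]; split; first exact: L2B.
by rewrite innerL2Bl ?u0 ?v0 ?subrr//; exact: L2_cst.
Qed.

Lemma coef_linear (a : R) u v : L2 u -> L2 v ->
  coef (fun x => a * u x + v x) = fun n => a * coef u n + coef v n.
Proof.
by move=> ? ?; apply/funext => n; rewrite /coef innerL2_linearl//; exact: L2_cosbasis.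
Qed.

Lemma coefB u v : L2 u -> L2 v ->
  coef (fun x => u x - v x) = fun n => coef u n - coef v n.
Proof.
by move=> ? ?; apply/funext => n; rewrite /coef innerL2Bl//; exact: L2_cosbasis.
Qed.

Lemma eq_coef u v : L2 u -> L2 v -> eqL2 u v -> coef u = coef v.
Proof.
by move=> ? ? ?; apply/funext => n; apply: innerL2_eql => //; exact: L2_cosbasis.
Qed.

(** Frequency 0, which [coef] does not see, is supplied by the zero mean of elements of [L2perp];
    the rest is completeness of the cosines. *)
Lemma coef_inj u v : L2perp u -> L2perp v -> coef u = coef v -> eqL2 u v.
Proof.
move=> uP vP uv; apply: eqL2_sub0; have uvP := L2perpB uP vP.
apply: eqL2_0_of_cos => [|[|n]]; first exact: L2perp_L2.
  have /L2perpP[_ uv0] := uvP; rewrite -[RHS]uv0; apply: eq_Rintegral => x _.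
  by rewrite mul0r cos0 mulr1.
have := congr1 (fun c => c n) (coefB (L2perp_L2 uP) (L2perp_L2 vP)).
rewrite /= uv subrr /coef /cosbasis innerL2Zr; [|exact: L2_cosM|exact: L2perp_L2].
by move=> /eqP; rewrite mulf_eq0 gt_eqF ?sqrtr_gt0 ?divr_gt0 ?pi_gt0//= => /eqP.
Qed.

Lemma coef_surj c (B : R) : (forall N, sqsum N c <= B) ->
  exists u, [/\ L2perp u, innerL2 u u <= B & coef u = c].
Proof.
move=> /(riesz_fischer cosbasis_measurable cosbasis_bounded cosbasis_orthonormal).
move=> [u [uL2 uB uc ug]]; exists u; split=> //; last by apply/funext; exact: uc.
split=> //; apply: (ug _ `|Num.sqrt 2 / 2|) => // [|n]; last exact: cosbasis_phi0.
exact: measurable_cst.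
Qed.

(** Parseval's inequality without convergence of the Fourier series: Riesz-Fischer yields a function
    with these coefficients and squared norm at most B, and it coincides with u almost
    everywhere. *)
Lemma le_innerL2_sqsum u (B : R) : L2perp u -> (forall N, sqsum N (coef u) <= B) ->
  innerL2 u u <= B.
Proof.
move=> uP /coef_surj[v [vP vB vu]].
have uv := coef_inj uP vP (esym vu).
have uL2 := L2perp_L2 uP; have vL2 := L2perp_L2 vP.
by rewrite (innerL2_eql uL2 vL2 uL2 uv) innerL2C (innerL2_eql uL2 vL2 vL2 uv).
Qed.

Lemma bessel_cos u N : L2 u -> sqsum N (coef u) <= innerL2 u u.
Proof. exact: bessel cosbasis_measurable cosbasis_bounded cosbasis_orthonormal u N. Qed.

Lemma coef_cosbasis n : coef (cosbasis n) = fun m => (n == m)%:R.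
Proof. by apply/funext => m; rewrite /coef cosbasis_orthonormal. Qed.

Lemma L2perp_cosbasis n : L2perp (cosbasis n).
Proof. by split; [exact: L2_cosbasis|exact: cosbasis_phi0]. Qed.

Lemma L2perp0 : L2perp (fun=> 0 : R).
Proof.
split; first exact: L2_cst.
by rewrite /innerL2; under eq_Rintegral do rewrite mul0r; rewrite Rintegral_cst// mul0r.
Qed.

Lemma L2perp_sum (I : Type) (r : seq I) (w : I -> R -> R) :
  (forall i, L2perp (w i)) -> L2perp (fun x => \sum_(i <- r) w i x).
Proof.
move=> wP; elim: r => [|i r ih].
  by under eq_fun do rewrite big_nil; exact: L2perp0.
under eq_fun do rewrite big_cons -[w i _]mul1r; exact: L2perp_linear.
Qed.

Lemma L2perpZ (a : R) u : L2perp u -> L2perp (fun x => a * u x).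
Proof.
by move=> uP; have := L2perp_linear a uP L2perp0; under eq_fun do rewrite addr0.
Qed.

Section lift.
Variables (A : (nat -> R) -> nat -> R) (B : R).
Hypothesis A_linear : forall (a : R) x y j,
  A (fun n => a * x n + y n) j = a * A x j + A y j.
Hypothesis A_bounded : forall N c, sqsum N (A c) <= B * sqsum N c.
Hypothesis B0 : 0 < B.

Let A_sqsum u N : L2 u -> sqsum N (A (coef u)) <= B * innerL2 u u.
Proof.
by move=> uL2; apply: le_trans (A_bounded _ _) _; rewrite ler_wpM2l ?(ltW B0)// bessel_cos.
Qed.

(** The representative is chosen arbitrarily, so linearity can hold only up to [eqL2]. Riesz-Fischer
    applies because [A_bounded] controls every truncation of A (coef u). *)
Definition lift u : R -> R := get [set v | L2perp v /\ coef v = A (coef u)].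

Let liftP u : L2 u -> L2perp (lift u) /\ coef (lift u) = A (coef u).
Proof.
move=> uL2; apply: (@getPex _ [set v | L2perp v /\ coef v = A (coef u)]).
have [v [vP _ vc]] := coef_surj (fun N => A_sqsum N uL2).
by exists v.
Qed.

Lemma L2perp_lift u : L2 u -> L2perp (lift u).
Proof. by move=> /liftP[]. Qed.

Lemma coef_lift u : L2 u -> coef (lift u) = A (coef u).
Proof. by move=> /liftP[]. Qed.

Lemma lift_bound u v : L2perp u -> L2perp v ->
  innerL2 (fun x => lift v x - lift u x) (fun x => lift v x - lift u x) <=
  B * innerL2 (fun x => v x - u x) (fun x => v x - u x).
Proof.
move=> uP vP; have uL2 := L2perp_L2 uP; have vL2 := L2perp_L2 vP.
apply: le_innerL2_sqsum => [|N]; first by apply: L2perpB; exact: L2perp_lift.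
have -> : coef (fun x => lift v x - lift u x) = A (coef (fun x => v x - u x)).
  rewrite !coefB ?coef_lift//; try by apply/L2perp_L2/L2perp_lift.
  apply/funext => n; have := A_linear (-1) (coef u) (coef v) n.
  rewrite mulN1r addrC => <-; congr (A _ n); apply/funext => m.
  by rewrite mulN1r addrC.
exact/A_sqsum/L2B.
Qed.

Lemma lift_continuous_linear : continuous_linear L2perp lift.
Proof.
split.
- by move=> u /L2perp_L2/L2perp_lift.
- move=> u v /L2perp_L2 uL2 /L2perp_L2 vL2 uv; apply: coef_inj.
  + exact: L2perp_lift.
  + exact: L2perp_lift.
  + by rewrite !coef_lift// (eq_coef uL2 vL2).
- move=> a u v /L2perp_L2 uL2 /L2perp_L2 vL2; apply: coef_inj.
  + exact/L2perp_lift/L2_linear.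
  + by apply: L2perp_linear; exact: L2perp_lift.
  + rewrite coef_lift ?coef_linear ?coef_lift//; last 1 first.
    * exact: L2_linear.
    * by apply/funext => n; rewrite A_linear.
    * exact/L2perp_L2/L2perp_lift.
    * exact/L2perp_L2/L2perp_lift.
- move=> u uP e e0; exists (e / Num.sqrt B); first by rewrite divr_gt0 ?sqrtr_gt0.
  move=> v vP; rewrite !normL2_lt ?divr_gt0 ?sqrtr_gt0//.
  rewrite expr_div_n sqr_sqrtr ?(ltW B0)// ltr_pdivlMr// mulrC.
  exact: le_lt_trans (lift_bound uP vP).
Qed.

End lift.
End cosine_basis.

(** * Riesz bases from divisibility-triangular perturbations *)

Section perturbed_basis.
Context {R : realType}.
Implicit Types (u v w : R -> R) (c : nat -> R).

Notation coef := (coef (@cosbasis R)).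

Variables (F : nat -> R -> R) (b : nat -> R) (q a C : R).
Hypothesis F_L2perp : forall n, L2perp (F n).
Hypothesis F_dvd : forall j n, ~~ (n.+1 %| j.+1)%N -> coef (F n) j = 0.
Hypothesis F_offdiag : forall j n k, (2 <= k)%N -> (k * n.+1)%N = j.+1 ->
  `|coef (F n) j| <= b k * coef (F n) n.
Hypothesis b0 : forall k, 0 <= b k.
Hypothesis bq : forall N, \sum_(2 <= k < N) b k <= q.
Hypothesis q0 : 0 < q.
Hypothesis q1 : q < 1.
Hypothesis a0 : 0 < a.
Hypothesis aF : forall n, a <= coef (F n) n.
Hypothesis FC : forall n, coef (F n) n <= C.

Let M (j n : nat) : R := coef (F n) j.

Let M_diag j : M j j != 0.
Proof. by rewrite gt_eqF// (lt_le_trans a0 (aF j)). Qed.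

Let Cgt0 : 0 < 4 * C ^+ 2.
Proof.
by rewrite mulr_gt0// exprn_gt0// (lt_le_trans a0)// (le_trans (aF 0)).
Qed.

Let tri_M_bounded N c : sqsum N (tri M c) <= 4 * C ^+ 2 * sqsum N c.
Proof. exact: (@tri_bound R M b q a C F_dvd F_offdiag b0 bq q0 q1 a0 aF FC). Qed.

Let B' := (a * (1 - q)) ^- 2.

Let B'gt0 : 0 < B'.
Proof. by rewrite invr_gt0 exprn_gt0 ?mulr_gt0 ?subr_gt0. Qed.

Let tri_inv_M_bounded N c : sqsum N (tri_inv M c) <= B' * sqsum N c.
Proof.
have := @tri_lower_bound R M b q a F_dvd F_offdiag b0 bq q0 q1 a0 aF N (tri_inv M c).
rewrite -/M (_ : tri M (tri_inv M c) = c)//.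
by apply/funext => j; exact: tri_invE.
Qed.

Lemma coef_F_sum c N :
  coef (fun x => \sum_(0 <= n < N) c n * F n x) = tri M (fun n => (n < N)%N%:R * c n).
Proof.
apply/funext => j; rewrite /coef innerL2_suml; last 2 first.
- by move=> n; exact/L2Zl/L2perp_L2.
- exact: L2_cosbasis.
have cE n : innerL2 (fun x => c n * F n x) (cosbasis j) = M j n * c n.
  by rewrite innerL2Zl; [rewrite mulrC|exact: L2perp_L2|exact: L2_cosbasis].
under eq_bigr do rewrite cE.
have Mjn n : (j < n)%N -> M j n = 0.
  by move=> jn; rewrite /M F_dvd// gtnNdvd.
(* Both sums are extended to a common range: the terms added on one side vanish by truncation, those
   on the other by triangularity. *)
pose m := maxn N j.+1.
transitivity (\sum_(0 <= n < m) M j n * ((n < N)%N%:R * c n)).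
  rewrite [RHS](big_cat_nat (n := N))//= ?leq_maxl// [X in _ + X]big_nat [X in _ + X]big1.
    rewrite addr0 big_nat [RHS]big_nat; apply: eq_bigr => n /= nN.
    by rewrite nN mul1r.
  by move=> n /andP[Nn _]; rewrite ltnNge Nn mul0r mulr0.
rewrite /tri [LHS](big_cat_nat (n := j.+1))//= ?leq_maxr// [X in _ + X]big_nat
  [X in _ + X]big1 ?addr0//.
by move=> n /andP[jn _]; rewrite Mjn// mul0r.
Qed.

(** The homeomorphism is M acting on cosine coefficients. It maps the n-th basis function to the
    n-th column of M, the coefficient sequence of [F n]; forward substitution gives its inverse. *)
Lemma F_riesz_basis : riesz_basis_in L2perp F.
Proof.
have t_lin (x : R) c c' j : tri M (fun n => x * c n + c' n) j = x * tri M c j + tri M c' j.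
  exact: tri_linear.
have ti_lin (x : R) c c' j :
    tri_inv M (fun n => x * c n + c' n) j = x * tri_inv M c j + tri_inv M c' j.
  exact: tri_inv_linear.
have t_lift := L2perp_lift tri_M_bounded Cgt0.
have ti_lift := L2perp_lift tri_inv_M_bounded B'gt0.
have t_coef := coef_lift tri_M_bounded Cgt0.
have ti_coef := coef_lift tri_inv_M_bounded B'gt0.
exists (@cosbasis R), (lift (tri M)); split.
- split=> [n|u uP e e0]; first exact: L2perp_cosbasis.
  have uL2 := L2perp_L2 uP.
  have [N0 hN0] := @sqsum_cauchy R (coef u) _ (fun N => bessel_cos N uL2)
    _ (exprn_gt0 2 e0).
  exists (coef u), N0 => N N0N; rewrite normL2_le ?(ltW e0)//.
  rewrite [leLHS](inner_sub_psum cosbasis_measurable cosbasis_bounded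
    cosbasis_orthonormal N.+1 uL2).
  (* The squared error is the squared norm minus a partial sum of squares, so it is a tail by
     Parseval. *)
  rewrite lerBlDr addrC; apply: le_innerL2_sqsum => // N'.
  apply: le_trans (hN0 N') _; rewrite lerD2r le_sqsum//.
  by rewrite (leq_trans N0N).
- exact: cosbasis_orthonormal.
- split; first exact: (lift_continuous_linear t_lin tri_M_bounded Cgt0).
  exists (lift (tri_inv M)); split.
  + exact: (lift_continuous_linear ti_lin tri_inv_M_bounded B'gt0).
  + move=> u uP; have uL2 := L2perp_L2 uP; have tu := t_lift _ uL2.
    apply: coef_inj => //; first exact/ti_lift/L2perp_L2.
    rewrite ti_coef; last exact: L2perp_L2.
    rewrite t_coef//; apply/funext => j; exact: tri_invK.
  + move=> u uP; have uL2 := L2perp_L2 uP; have tu := ti_lift _ uL2.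
    apply: coef_inj => //; first exact/t_lift/L2perp_L2.
    rewrite t_coef; last exact: L2perp_L2.
    rewrite ti_coef//; apply/funext => j; exact: tri_invE.
- move=> n; split=> //; apply: coef_inj => //.
    by apply: t_lift; exact: L2_cosbasis.
  rewrite t_coef; last exact: L2_cosbasis.
  rewrite coef_cosbasis; apply/funext => j; rewrite /tri.
  have [nj|jn] := ltnP n j.+1.
    rewrite (bigD1_seq n) ?iota_uniq ?mem_index_iota//= eqxx mulr1 big1 ?addr0//.
    by move=> i /negbTE; rewrite eq_sym => ->; rewrite mulr0.
  rewrite big_nat big1 => [|i /andP[_ ij]].
    by rewrite F_dvd// gtnNdvd.
  by rewrite gtn_eqF ?mulr0// (leq_trans ij).
Qed.

(** Expand u with the coefficients d obtained by inverting M and truncate: the error has as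
    coefficients M applied to the tail of d, and N is chosen so that this tail has square sum at
    most e / (4 C^2). *)
Lemma F_span_dense u (e : R) : L2perp u -> 0 < e ->
  exists (d : nat -> R) (N : nat),
    innerL2 (fun x => u x - \sum_(0 <= n < N) d n * F n x)
            (fun x => u x - \sum_(0 <= n < N) d n * F n x) <= e.
Proof.
move=> uP e0; have uL2 := L2perp_L2 uP.
pose d := tri_inv M (coef u).
have dB N : sqsum N d <= B' * innerL2 u u.
  by rewrite (le_trans (tri_inv_M_bounded _ _))// ler_wpM2l ?(ltW B'gt0)// bessel_cos.
have [N dN] := sqsum_cauchy dB (divr_gt0 e0 Cgt0).
exists d, N; have sP : L2perp (fun x => \sum_(0 <= n < N) d n * F n x).
  by apply: L2perp_sum => n; exact: L2perpZ.
apply: le_innerL2_sqsum => [|N']; first exact: L2perpB.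
rewrite coefB//; last exact: L2perp_L2.
rewrite coef_F_sum (_ : (fun _ => _) = tri M (fun n => (N <= n)%N%:R * d n)).
  apply: le_trans (tri_M_bounded _ _) _; rewrite mulrC -ler_pdivlMr//.
  rewrite -(lerD2l (sqsum N d)); apply: le_trans (dN (maxn N N')).
  rewrite /sqsum [leRHS](big_cat_nat (n := N))//= ?leq_maxl// lerD2l.
  apply: (@le_trans _ _ (\sum_(0 <= n < maxn N N') ((N <= n)%N%:R * d n) ^+ 2)).
    by apply: (@le_sqsum R N' _ (fun n => (N <= n)%N%:R * d n)); exact: leq_maxr.
  rewrite (big_cat_nat (n := N))//= ?leq_maxl// big_nat big1 ?add0r.
    rewrite big_nat [leRHS]big_nat; apply: ler_sum => n /andP[Nn _].
    by rewrite Nn mul1r.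
  by move=> n /= nN; rewrite leqNgt nN mul0r expr0n.
apply/funext => j.
rewrite -[coef u j](@tri_invE _ M)// -/d /tri -sumrB; apply: eq_bigr => n _.
by rewrite -mulrBr; congr (_ * _); case: ltnP => _; rewrite ?mul1r ?mul0r ?subrr ?subr0.
Qed.

End perturbed_basis.

(** * The Fucik equation *)

Section fucik_ode.
Context {R : realType}.
Implicit Types (u v w z : R -> R) (a b c d p q r x y s t : R).

(* Gronwall estimate for the energy z^2 + z'^2. *)
Lemma energy_growth (L a a1 a2 : R) : 0 <= L -> `|a2| <= L * `|a| ->
  (a * a1 + a * a1) + (a1 * a2 + a1 * a2) <= (1 + L) * (a * a + a1 * a1).
Proof.
move=> L0 a2L.
have h1 : a1 * a2 <= L * (`|a| * `|a1|).
  rewrite (le_trans (ler_norm _))// normrM mulrC mulrA ler_wpM2r//.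
have h2 : 2 * (`|a| * `|a1|) <= a * a + a1 * a1.
  rewrite -!expr2 -[a ^+ 2]real_normK ?num_real// -[a1 ^+ 2]real_normK ?num_real//.
  by have := sqr_ge0 (`|a| - `|a1|); nra.
have h3 := ler_wpM2l L0 h2; have := sqr_ge0 (a - a1); nra.
Qed.

(** The energy times exp(-(1 + L) x) is nonnegative, nonincreasing and tends to 0 at p. Initial data
    are right limits because the equation is assumed only in the open interval. *)
Lemma second_order_unique z z1 z2 p q (L : R) : 0 <= L ->
  (forall x, x \in `]p, q[ -> is_derive x 1 z (z1 x)) ->
  (forall x, x \in `]p, q[ -> is_derive x 1 z1 (z2 x)) ->
  (forall x, x \in `]p, q[ -> `|z2 x| <= L * `|z x|) ->
  z x @[x --> p^'+] --> 0 -> z1 x @[x --> p^'+] --> 0 ->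
  forall x, x \in `]p, q[ -> z x = 0 /\ z1 x = 0.
Proof.
move=> L0 dz dz1 zL zp z1p.
pose E x : R := z x * z x + z1 x * z1 x.
pose G x : R := E x * expR (- (1 + L) * x).
pose dG x : R := ((z x * z1 x + z x * z1 x) + (z1 x * z2 x + z1 x * z2 x)
   - (1 + L) * E x) * expR (- (1 + L) * x).
have GE x : x \in `]p, q[ -> is_derive x 1 G (dG x).
  move=> xpq; have ? := dz _ xpq; have ? := dz1 _ xpq.
  have ? : is_derive x 1 (fun y => expR (- (1 + L) * y))
      (expR (- (1 + L) * x) * - (1 + L)).
    by apply: is_derive_comp_real; exact: is_derive_mull.
  have ? : is_derive x 1 E ((z x * z1 x + z x * z1 x) + (z1 x * z2 x + z1 x * z2 x)).
    by apply: (@is_deriveD _ _ _ (z * z) (z1 * z1)); exact: is_deriveM.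
  apply: (@is_derive_eq _ _ _ _ _ _ _
    (E x *: (expR (- (1 + L) * x) * - (1 + L)) + expR (- (1 + L) * x) *: _)).
    exact: is_deriveM.
  by rewrite /dG /GRing.scale/=; ring.
have dG0 x : x \in `]p, q[ -> dG x <= 0.
  move=> xpq; rewrite /dG -oppr_ge0 -mulNr mulr_ge0 ?expR_ge0// oppr_ge0 subr_le0.
  exact: energy_growth (zL _ xpq).
have Gmono x y : x \in `]p, q[ -> y \in `]p, q[ -> x <= y -> G y <= G x.
  rewrite !in_itv/= => /andP[px xq] /andP[py yq] xy.
  have sub t : x <= t <= y -> t \in `]p, q[.
    by move=> /andP[xt ty]; rewrite in_itv/= (lt_le_trans px)//= (le_lt_trans ty).
  apply: (@ler0_derive1_nincr _ G x y) => //.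
  - move=> t; rewrite in_itv/= => /andP[/ltW xt /ltW ty].
    by have [] := GE t (sub t _); rewrite ?xt.
  - move=> t; rewrite in_itv/= => /andP[/ltW xt /ltW ty].
    have tpq : t \in `]p, q[ by rewrite sub// xt.
    by have ? := GE t tpq; rewrite derive1E derive_val dG0.
  - apply: derivable_within_continuous => t; rewrite in_itv/= => txy.
    by have [] := GE t (sub t txy).
have Gp : G x @[x --> p^'+] --> 0.
  have Ep : E x @[x --> p^'+] --> (0 * 0 + 0 * 0 : R) by apply: cvgD; apply: cvgM.
  rewrite mul0r addr0 in Ep.
  rewrite -(mul0r (expR (- (1 + L) * p))); apply: cvgM => //.
  apply: cvg_at_right_filter; apply: (@continuous_comp _ _ _ (fun y => - (1 + L) * y)).
    by apply: cvgM; [exact: cvg_cst|exact: cvg_id].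
  exact: continuous_expR.
move=> y ypq; have G0 : G y <= 0.
  apply: (cvgr_to_ge Gp); near=> x; apply: Gmono => //.
    rewrite in_itv/=; apply/andP; split; near: x;
      [exact: nbhs_right_gt|apply: nbhs_right_lt].
    by move: ypq; rewrite in_itv/= => /andP[]; exact: lt_trans.
  by near: x; apply: nbhs_right_le; move: ypq; rewrite in_itv/= => /andP[].
have : E y = 0.
  apply/eqP; rewrite eq_le addr_ge0 -?expr2 ?sqr_ge0// andbT.
  by move: G0; rewrite /G pmulr_lle0// expR_gt0.
move=> /eqP; rewrite paddr_eq0 -?expr2 ?sqr_ge0// !sqrf_eq0.
by move=> /andP[/eqP -> /eqP ->].
Unshelve. all: by end_near. Qed.

End fucik_ode.

(** * Uniqueness for the Fucik equation and the explicit half wave *)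

Section fucik_solutions.
Context {R : realType}.
Implicit Types (u v w : R -> R) (a b c d p q r x y s t : R).

Definition fucik_on a b u u1 p q := forall x, x \in `]p, q[ ->
  is_derive x 1 u (u1 x) /\
  is_derive x 1 u1 (b * Num.max (- u x) 0 - a * Num.max (u x) 0).

Lemma ler_dist_max0 x y : `|Num.max x 0 - Num.max y 0| <= `|x - y|.
Proof.
have h a b : Num.max a 0 - Num.max b 0 <= `|a - b|.
  have := ler_norm (a - b); have := normr_ge0 (a - b).
  by case: (leP a 0) => ?; case: (leP b 0) => ? ? ?; lra.
by rewrite ler_norml h lerNl opprB andbT [leRHS]distrC h.
Qed.

(** Positive and negative parts are 1-Lipschitz, so the difference z of two solutions satisfies
    |z''| <= (a + b) |z|. *)
Lemma fucik_unique a b u u1 w w1 p q c d : 0 <= a -> 0 <= b ->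
  fucik_on a b u u1 p q -> fucik_on a b w w1 p q ->
  u x @[x --> p^'+] --> c -> u1 x @[x --> p^'+] --> d ->
  w x @[x --> p^'+] --> c -> w1 x @[x --> p^'+] --> d ->
  forall x, x \in `]p, q[ -> u x = w x /\ u1 x = w1 x.
Proof.
move=> a0 b0 uf wf uc ud wc wd x xpq.
suff [/eqP + /eqP] : u x - w x = 0 /\ u1 x - w1 x = 0.
  by rewrite !subr_eq0 => /eqP -> /eqP ->.
pose z2 x := (b * Num.max (- u x) 0 - a * Num.max (u x) 0) -
  (b * Num.max (- w x) 0 - a * Num.max (w x) 0).
apply: (@second_order_unique R (fun x => u x - w x) (fun x => u1 x - w1 x) z2
  p q (a + b)) => //.
- by rewrite addr_ge0.
- by move=> y ypq; have [? _] := uf y ypq; have [? _] := wf y ypq; exact: is_deriveB.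
- by move=> y ypq; have [_ ?] := uf y ypq; have [_ ?] := wf y ypq; exact: is_deriveB.
- move=> y _; rewrite /z2.
  have -> : b * Num.max (- u y) 0 - a * Num.max (u y) 0 -
      (b * Num.max (- w y) 0 - a * Num.max (w y) 0) =
    b * (Num.max (- u y) 0 - Num.max (- w y) 0) -
      a * (Num.max (u y) 0 - Num.max (w y) 0) by ring.
  rewrite (le_trans (ler_normB _ _))// !normrM (ger0_norm a0) (ger0_norm b0) mulrDl addrC.
  rewrite lerD// ler_wpM2l// ?ler_dist_max0//.
  by rewrite (le_trans (ler_dist_max0 _ _))// -opprD normrN.
- by rewrite -(subrr c); exact: cvgB.
- by rewrite -(subrr d); exact: cvgB.
Qed.

(** Turns the terminal values of one explicit piece into initial data for the next. *)
Lemma eq_left_cvg_right u w p q : p < q ->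
  {for q, continuous u} -> {for q, continuous w} ->
  (forall x, x \in `]p, q[ -> u x = w x) ->
  u q = w q /\ u x @[x --> q^'+] --> w q.
Proof.
move=> pq uq wq uw.
have ul : u x @[x --> q^'-] --> u q by exact: cvg_at_left_filter.
have wl : w x @[x --> q^'-] --> w q by exact: cvg_at_left_filter.
have uwq : u q = w q.
  apply: (cvg_unique _ ul) => //; apply: cvg_trans wl.
  apply: near_eq_cvg; near=> x; rewrite uw// in_itv/=; apply/andP; split; near: x.
    exact: nbhs_left_gt.
  exact: nbhs_left_lt.
by split=> //; rewrite -uwq; exact: cvg_at_right_filter.
Unshelve. all: by end_near. Qed.

Lemma mulr_div2l x s : s != 0 -> s * (x / (2 * s)) = x / 2.
Proof. by move=> s0; field. Qed.

(* Half a period of an eigenfunction, from its maximum c at 0 down to its minimum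
   at pi/(2s) + pi/(2t); for each y one of the two terms vanishes. *)
Definition halfwave c s t y : R := c * cos (s * Num.min y (pi / (2 * s)))
  - c * s / t * sin (t * Num.max (y - pi / (2 * s)) 0).

Lemma is_derive_shift_cos c s p x :
  is_derive x 1 (fun y => c * cos (s * (y - p))) (- (c * s) * sin (s * (x - p))).
Proof.
have ? : is_derive x 1 (fun y => s * (y - p)) s.
  rewrite -[X in is_derive _ _ _ X]mulr1; apply: is_derive_scale.
  by apply: (@is_derive_eq _ _ _ (id - cst p)); rewrite subr0.
rewrite (_ : - (c * s) * _ = c * (- sin (s * (x - p)) * s)); last by ring.
apply: is_derive_scale; exact: is_derive_comp_real.
Qed.

Lemma is_derive_shift_sin c s p x :
  is_derive x 1 (fun y => c * sin (s * (y - p))) (c * s * cos (s * (x - p))).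
Proof.
have ? : is_derive x 1 (fun y => s * (y - p)) s.
  rewrite -[X in is_derive _ _ _ X]mulr1; apply: is_derive_scale.
  by apply: (@is_derive_eq _ _ _ (id - cst p)); rewrite subr0.
rewrite (_ : c * s * _ = c * (cos (s * (x - p)) * s)); last by ring.
apply: is_derive_scale; exact: is_derive_comp_real.
Qed.

Lemma is_derive_continuous u x d : is_derive x 1 u d -> {for x, continuous u}.
Proof.
by move=> [du _]; apply: differentiable_continuous; exact/derivable1_diffP.
Qed.

Lemma fucik_continuous a b u u1 p q x : fucik_on a b u u1 p q -> x \in `]p, q[ ->
  {for x, continuous u} /\ {for x, continuous u1}.
Proof. by move=> uf /uf[? ?]; split; exact: is_derive_continuous. Qed.

Lemma fucik_onS a b u u1 p q p' q' : p <= p' -> q' <= q ->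
  fucik_on a b u u1 p q -> fucik_on a b u u1 p' q'.
Proof.
move=> pp qq uf x; rewrite in_itv/= => /andP[px xq]; apply: uf.
by rewrite in_itv/= (le_lt_trans pp)//= (lt_le_trans xq).
Qed.

(** From p to q = p + pi/(2s) the solution is a cosine of frequency s. It reaches q with value 0 and
    slope - c s, the data of a sine of frequency t and amplitude c s / t, followed down to its
    minimum at r. Data to the right of r make sense only if r lies inside the interval. *)
Lemma fucik_half u u1 p P c s t (r := p + pi / (2 * s) + pi / (2 * t)) :
  0 < c -> 0 < s -> 0 < t -> r <= P -> fucik_on (s ^+ 2) (t ^+ 2) u u1 p P ->
  u x @[x --> p^'+] --> c -> u1 x @[x --> p^'+] --> 0 ->
  (forall x, x \in `]p, r[ -> u x = halfwave c s t (x - p)) /\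
  (r < P -> u x @[x --> r^'+] --> - (c * s / t) /\ u1 x @[x --> r^'+] --> 0).
Proof.
move=> c0 s0 t0 rP uf uc u10.
have th0 : 0 < pi / (2 * s) by rewrite divr_gt0 ?pi_gt0 ?mulr_gt0.
have th0' : 0 < pi / (2 * t) by rewrite divr_gt0 ?pi_gt0 ?mulr_gt0.
have sth : s * (pi / (2 * s)) = pi / 2 by rewrite mulr_div2l// gt_eqF.
have tth : t * (pi / (2 * t)) = pi / 2 by rewrite mulr_div2l// gt_eqF.
move: th0 th0' sth tth rP; rewrite /halfwave {}/r.
move: (pi / (2 * s)) (pi / (2 * t)) => th th' th0 th0' sth tth rP.
pose q := p + th; pose r := q + th'; rewrite -/q -/r in rP *.
have pq : p < q by rewrite ltrDl.
have qr : q < r by rewrite ltrDl.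
have qP : q < P by exact: lt_le_trans rP.
have cs0 : 0 < c * s / t by rewrite divr_gt0 ?mulr_gt0.
pose w x := c * cos (s * (x - p)); pose w1 x := - (c * s) * sin (s * (x - p)).
have wd x : is_derive x 1 w (w1 x) by exact: is_derive_shift_cos.
have w1d x : is_derive x 1 w1 (- (c * s) * s * cos (s * (x - p))).
  exact: is_derive_shift_sin.
have wf : fucik_on (s ^+ 2) (t ^+ 2) w w1 p q.
  move=> x; rewrite in_itv/= => /andP[px xq]; split; first exact: wd.
  have w0 : 0 <= w x.
    rewrite mulr_ge0 ?ltW// cos_gt0_pihalf// -sth ltr_pM2l// ltrBlDl xq andbT.
    by rewrite (@lt_le_trans _ _ 0) ?oppr_lt0 ?mulr_gt0// mulr_ge0 ?ltW// subr_gt0.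
  rewrite max_r ?oppr_le0// max_l// mulr0 sub0r.
  by rewrite (_ : - _ = - (c * s) * s * cos (s * (x - p)))// /w; ring.
have wp : w x @[x --> p^'+] --> c.
  rewrite [X in _ --> X](_ : c = w p); last by rewrite /w subrr mulr0 cos0 mulr1.
  by apply: cvg_at_right_filter; exact: is_derive_continuous.
have w1p : w1 x @[x --> p^'+] --> 0.
  rewrite [X in _ --> X](_ : 0 = w1 p); last by rewrite /w1 subrr mulr0 sin0 mulr0.
  by apply: cvg_at_right_filter; exact: is_derive_continuous.
have s2 : 0 <= s ^+ 2 by rewrite sqr_ge0.
have t2 : 0 <= t ^+ 2 by rewrite sqr_ge0.
have uw := fucik_unique s2 t2 (fucik_onS (lexx p) (ltW qP) uf) wf uc u10 wp w1p.
have qpP : q \in `]p, P[ by rewrite in_itv/= pq.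
have [uq u1q] := fucik_continuous uf qpP.
have [uqE uq'] := eq_left_cvg_right pq uq (is_derive_continuous (wd q))
  (fun x xpq => (uw x xpq).1).
have [_ u1q'] := eq_left_cvg_right pq u1q (is_derive_continuous (w1d q))
  (fun x xpq => (uw x xpq).2).
have qpE : q - p = th by rewrite /q addrC addKr.
have wq : w q = 0 by rewrite /w qpE sth cos_pihalf mulr0.
have w1q : w1 q = - (c * s) by rewrite /w1 qpE sth sin_pihalf mulr1.
rewrite {}wq in uqE uq'; rewrite {}w1q in u1q'.
pose v x := - (c * s / t) * sin (t * (x - q)).
pose v1 x := - (c * s / t) * t * cos (t * (x - q)).
have vd x : is_derive x 1 v (v1 x) by exact: is_derive_shift_sin.
have v1d x : is_derive x 1 v1 (- (- (c * s / t) * t * t) * sin (t * (x - q))).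
  exact: is_derive_shift_cos.
have vf : fucik_on (s ^+ 2) (t ^+ 2) v v1 q r.
  move=> x; rewrite in_itv/= => /andP[qx xr]; split; first exact: vd.
  have v0 : v x <= 0.
    rewrite /v mulNr oppr_le0 mulr_ge0 ?(ltW cs0)// sin_ge0_pi//.
    rewrite mulr_ge0 ?(ltW t0) ?subr_ge0 ?(ltW qx)//=.
    apply: (@le_trans _ _ (t * th')); first by rewrite ler_pM2l// lerBlDl ltW.
    by rewrite tth ler_pdivrMr// ler_peMr ?pi_ge0// ler1n.
  rewrite max_l ?oppr_ge0// max_r// mulr0 subr0.
  by rewrite (_ : _ * - v x = - (- (c * s / t) * t * t) * sin (t * (x - q)))// /v; ring.
have vq : v x @[x --> q^'+] --> 0.
  rewrite [X in _ --> X](_ : 0 = v q); last by rewrite /v subrr mulr0 sin0 mulr0.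
  by apply: cvg_at_right_filter; exact: is_derive_continuous.
have v1q : v1 x @[x --> q^'+] --> - (c * s).
  rewrite [X in _ --> X](_ : _ = v1 q); last first.
    by rewrite /v1 subrr mulr0 cos0 mulr1 mulNr divfK// gt_eqF.
  by apply: cvg_at_right_filter; exact: is_derive_continuous.
have uv := fucik_unique s2 t2 (fucik_onS (ltW pq) rP uf) vf uq' u1q' vq v1q.
split=> [x|rP'].
  rewrite in_itv/= => /andP[px xr]; have [xq|qx|->] := ltgtP x q.
  - rewrite (uw x _).1 ?in_itv/= ?px// /w min_l ?lerBlDl ?(ltW xq)//.
    by rewrite max_r ?mulr0 ?sin0 ?mulr0 ?subr0// subr_le0 lerBlDl ltW.
  - rewrite (uv x _).1 ?in_itv/= ?qx// /v min_r ?lerBrDl ?(ltW qx)//.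
    rewrite sth cos_pihalf mulr0 sub0r max_l.
      by rewrite mulNr /q opprD addrA.
    by rewrite subr_ge0 lerBrDl ltW.
  - rewrite uqE qpE minxx subrr maxxx sth cos_pihalf !mulr0 sin0 mulr0.
    by rewrite subrr.
have rpP : r \in `]p, P[ by rewrite in_itv/= rP' (lt_trans pq).
have [ur u1r] := fucik_continuous uf rpP.
have [_ ur'] := eq_left_cvg_right qr ur (is_derive_continuous (vd r))
  (fun x xqr => (uv x xqr).1).
have [_ u1r'] := eq_left_cvg_right qr u1r (is_derive_continuous (v1d r))
  (fun x xqr => (uv x xqr).2).
have rqE : r - q = th' by rewrite /r addrC addKr.
rewrite (_ : - (c * s / t) = v r); last by rewrite /v rqE tth sin_pihalf mulr1.
by rewrite (_ : 0 = v1 r); last by rewrite /v1 rqE tth cos_pihalf mulr0.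
Qed.

End fucik_solutions.

(** * Fucik eigenfunctions *)

Section fucik_pieces.
Context {R : realType}.
Implicit Types (u v w : R -> R) (a b c d p q r x y s t : R).

Notation mu := (@lebesgue_measure R).
Notation D := (@dom0pi R).

Lemma continuous_halfwave c s t : continuous (halfwave c s t).
Proof.
move=> y; apply: cvgB; (apply: cvgM; first exact: cvg_cst).
  apply: (@continuous_comp _ _ _ (fun y => s * Num.min y (pi / (2 * s))) cos).
    apply: cvgM; first exact: cvg_cst.
    by apply: (@continuous_min _ _ id (cst (pi / (2 * s))));
      [exact: cvg_id|exact: cvg_cst].
  exact: continuous_cos.
apply: (@continuous_comp _ _ _ (fun y => t * Num.max (y - pi / (2 * s)) 0) sin);
  last exact: continuous_sin.
apply: cvgM; first exact: cvg_cst.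
apply: (@continuous_max _ _ (fun y => y - pi / (2 * s)) (cst 0)); last exact: cvg_cst.
by apply: cvgB; [exact: cvg_id|exact: cvg_cst].
Qed.

Lemma halfwave_le c s t y : 0 < s -> y <= pi / (2 * s) -> halfwave c s t y = c * cos (s * y).
Proof.
by move=> s0 ys; rewrite /halfwave min_l// max_r ?subr_le0// mulr0 sin0 mulr0 subr0.
Qed.

Lemma halfwave_ge c s t y : 0 < s -> pi / (2 * s) <= y ->
  halfwave c s t y = - (c * s / t) * sin (t * (y - pi / (2 * s))).
Proof.
move=> s0 sy; rewrite /halfwave min_r// max_l ?subr_ge0//.
by rewrite mulr_div2l ?gt_eqF// cos_pihalf mulr0 sub0r mulNr.
Qed.

Lemma halfwave_bound c s t y : 0 < c -> 0 < s -> 0 < t ->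
  `|halfwave c s t y| <= Num.max c (c * s / t).
Proof.
move=> c0 s0 t0; have cs0 : 0 < c * s / t by rewrite divr_gt0 ?mulr_gt0.
have [ys|/ltW ys] := leP y (pi / (2 * s)).
  by rewrite halfwave_le// normrM (gtr0_norm c0) le_max ler_piMr ?(ltW c0)// cos_max.
rewrite halfwave_ge// normrM normrN (gtr0_norm cs0) le_max.
by rewrite [X in _ || X]ler_piMr ?orbT ?(ltW cs0)// sin_max.
Qed.

(** Serves twice: ascending half periods of u become descending ones of -u, and the case s < t is
    reduced to t <= s. *)
Lemma halfwave_refl c s t y : 0 < s -> 0 < t ->
  - halfwave (c * s / t) t s y =
  halfwave c s t (pi / (2 * s) + pi / (2 * t) - y).
Proof.
move=> s0 t0; have s0' : s != 0 by rewrite gt_eqF.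
have t0' : t != 0 by rewrite gt_eqF.
have cst : c * s / t * t / s = c by field; rewrite s0' t0'.
set l : R := pi / (2 * s) + pi / (2 * t); have [yt|/ltW ty] := leP y (pi / (2 * t)).
  rewrite halfwave_le// halfwave_ge//; last by rewrite /l -addrA lerDl subr_ge0.
  rewrite (_ : t * (l - _ - _) = pi / 2 - t * y); last first.
    by rewrite /l -(mulr_div2l pi t0'); move: (pi / (2 * s)) (pi / (2 * t)) => *; ring.
  by rewrite -[pi / 2 - _]opprB sinN sinBpihalf opprK mulNr.
rewrite halfwave_ge// halfwave_le//; last by rewrite /l -addrA gerDl subr_le0.
rewrite cst (_ : s * (l - y) = - (s * (y - pi / (2 * t)) - pi / 2)).
  by rewrite cosN cosBpihalf mulNr opprK.
by rewrite /l -(mulr_div2l pi s0'); move: (pi / (2 * s)) (pi / (2 * t)) => *; ring.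
Qed.

Lemma fucik_onN a b u u1 p q : fucik_on a b u u1 p q ->
  fucik_on b a (fun x => - u x) (fun x => - u1 x) p q.
Proof.
move=> uf x /uf[ud u1d]; split; first exact: is_deriveN.
rewrite opprK (_ : _ - _ = - (b * Num.max (- u x) 0 - a * Num.max (u x) 0)).
  exact: is_deriveN.
by rewrite opprB.
Qed.

Section pieces.
Variables (n : nat) (s t c : R) (u u1 : R -> R).
Hypothesis n0 : (0 < n)%N.
Hypothesis s0 : 0 < s.
Hypothesis t0 : 0 < t.
Hypothesis c0 : 0 < c.
Let l := pi / (2 * s) + pi / (2 * t).
Hypothesis nl : n%:R * l = pi.
Hypothesis uf : fucik_on (s ^+ 2) (t ^+ 2) u u1 0 pi.
Hypothesis u0 : u x @[x --> 0^'+] --> c.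
Hypothesis u10 : u1 x @[x --> 0^'+] --> 0.

Let l0 : 0 < l.
Proof. by rewrite addr_gt0// divr_gt0 ?pi_gt0 ?mulr_gt0. Qed.

Let knot (i : nat) : R := i%:R * l.

Let knotS i : knot i.+1 = knot i + l.
Proof. by rewrite /knot -natr1 mulrDl mul1r. Qed.

Let knot_le_pi i : (i <= n)%N -> knot i <= pi.
Proof. by move=> ni; rewrite -nl ler_pM2r// ler_nat. Qed.

Let knot_ge0 i : 0 <= knot i. Proof. by rewrite mulr_ge0// ltW. Qed.

Let wave i x :=
  if odd i then halfwave c s t (knot i.+1 - x) else halfwave c s t (x - knot i).

(** Odd half periods rise from minimum to maximum. There -u solves the equation with s and t
    exchanged and starts with amplitude c s / t, so [fucik_half] applies to it and returns the
    amplitude c. *)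
Let step i : (i < n)%N ->
  u x @[x --> (knot i)^'+] --> (if odd i then - (c * s / t) else c) ->
  u1 x @[x --> (knot i)^'+] --> 0 ->
  (forall x, x \in `]knot i, knot i.+1[ -> u x = wave i x) /\
  (knot i.+1 < pi ->
    u x @[x --> (knot i.+1)^'+] --> (if odd i.+1 then - (c * s / t) else c) /\
    u1 x @[x --> (knot i.+1)^'+] --> 0).
Proof.
move=> ni ui u1i; have kipi : knot i.+1 <= pi by exact: knot_le_pi.
have ufi := fucik_onS (knot_ge0 i) (lexx pi) uf.
rewrite /wave /=; case: ifPn ui => oi ui /=.
  have cs0 : 0 < c * s / t by rewrite divr_gt0 ?mulr_gt0.
  have kE : knot i + pi / (2 * t) + pi / (2 * s) = knot i.+1.
    by rewrite knotS /l -addrA [pi / (2 * t) + _]addrC.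
  have := @fucik_half R (fun x => - u x) (fun x => - u1 x) (knot i) pi
    (c * s / t) t s cs0 t0 s0.
  rewrite kE => /(_ kipi (fucik_onN ufi)).
  case.
  - by rewrite -[X in _ --> X]opprK; exact: cvgN.
  - by rewrite -oppr0; exact: cvgN.
  move=> uw ur; split=> [x xi|/ur[ur1 ur2]].
    rewrite -[LHS]opprK uw// halfwave_refl//; congr halfwave.
    by rewrite knotS /l; move: (pi / (2 * s)) (pi / (2 * t)) => *; ring.
  have cst : c * s / t * t / s = c by field; rewrite !gt_eqF.
  rewrite cst in ur1; split.
    by rewrite -[X in _ --> X]opprK; under eq_fun do rewrite -[u _]opprK; exact: cvgN.
  by rewrite -oppr0; under eq_fun do rewrite -[u1 _]opprK; exact: cvgN.
have kE : knot i + pi / (2 * s) + pi / (2 * t) = knot i.+1 by rewrite knotS /l addrA.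
by have := fucik_half c0 s0 t0 _ ufi ui u1i; rewrite kE => /(_ kipi).
Qed.

Lemma fucik_pieces i x : (i < n)%N -> x \in `]knot i, knot i.+1[ -> u x = wave i x.
Proof.
suff H : (i < n)%N ->
    u x @[x --> (knot i)^'+] --> (if odd i then - (c * s / t) else c) /\
    u1 x @[x --> (knot i)^'+] --> 0.
  by move=> ni; have [ui u1i] := H ni; exact: (step ni ui u1i).1.
elim: i {x} => [_|i ih ni]; first by rewrite /knot mul0r.
have [ui u1i] := ih (ltnW ni).
apply: (step (ltnW ni) ui u1i).2.
by rewrite -nl ltr_pM2r// ltr_nat.
Qed.

Let find_knot x m : 0 < x <= knot m -> exists2 i, (i < m)%N & knot i < x <= knot i.+1.
Proof.
elim: m => [|m ih] /andP[x0 xm].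
  by move: xm; rewrite /knot mul0r leNgt x0.
have [xm'|mx] := leP x (knot m).
  have [|i im ix] := ih; first by rewrite x0.
  by exists i => //; exact: leqW.
by exists m => //; rewrite mx.
Qed.

Hypothesis upi : u x @[x --> pi^'-] --> u pi.
Hypothesis u0E : u 0 = c.

Let m := Num.max c (c * s / t).

Let wave_bound i x : `|wave i x| <= m.
Proof. by rewrite /wave; case: ifP => _; exact: halfwave_bound. Qed.

Lemma fucik_bound x : x \in `[0, pi] -> `|u x| <= m.
Proof.
rewrite in_itv/= le_eqVlt => /andP[/predU1P[<- _|x0 xpi]].
  by rewrite u0E gtr0_norm// le_max lexx.
have [|i ni /andP[ix xi]] := @find_knot x n; first by rewrite x0 /knot nl.
have ux : u y @[y --> x^'-] --> u x.
  move: xpi; rewrite le_eqVlt => /predU1P[->//|xpi].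
  have := @fucik_continuous R _ _ _ _ _ _ x uf; rewrite in_itv/= x0 xpi.
  by move=> /(_ isT)[ux _]; exact: cvg_at_left_filter.
(* Approaching x from the left stays inside one open piece, so knots and the endpoint pi are covered
   as well. *)
apply: (cvgr_to_le (cvg_norm ux)); near=> y.
have yx : y < x by near: y; exact: nbhs_left_lt.
rewrite (fucik_pieces ni) ?wave_bound// in_itv/= (lt_le_trans yx xi) andbT.
by near: y; exact: nbhs_left_gt.
Unshelve. all: by end_near. Qed.

(** The value c is taken at 0, and c s / t is approached from the left at the first knot; using a
    limit there includes n = 1, where this knot is pi. *)
Lemma fucik_sup : sup [set `|u x| | x in `[0, pi]] = m.
Proof.
set A := [set _ | _ in _].
have A0 : A `|u 0| by exists 0 => //=; rewrite in_itv/= lexx pi_ge0.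
have Am : ubound A m by move=> _ [x xpi <-]; exact: fucik_bound.
have hA : has_sup A by split; [exists (`|u 0|)|exists m].
apply/eqP; rewrite eq_le; apply/andP; split.
  by apply: ge_sup => //; exists `|u 0|.
rewrite ge_max; apply/andP; split.
  by rewrite -[leLHS](gtr0_norm c0) -u0E; apply: ub_le_sup => //; exact: hA.2.
have cs0 : 0 < c * s / t by rewrite divr_gt0 ?mulr_gt0.
have wl : `|wave 0 x| @[x --> (knot 1)^'-] --> c * s / t.
  have -> : c * s / t = `|wave 0 (knot 1)|.
    rewrite /wave/= /knot mul0r subr0 mul1r halfwave_ge//; last first.
      by rewrite /l lerDl divr_ge0 ?pi_ge0 ?mulr_ge0 ?(ltW t0).
    rewrite /l addrAC subrr add0r mulr_div2l ?gt_eqF// sin_pihalf mulr1 normrN.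
    by rewrite gtr0_norm.
  apply: cvg_norm; apply: cvg_at_left_filter; rewrite /wave/=.
  apply: (@continuous_comp _ _ _ (fun x => x - knot 0) (halfwave c s t)).
    by apply: cvgB; [exact: cvg_id|exact: cvg_cst].
  exact: continuous_halfwave.
apply: (cvgr_to_le wl); near=> x.
have x01 : x \in `]knot 0, knot 1[.
  rewrite in_itv/=; apply/andP; split; near: x.
    by apply: nbhs_left_gt; rewrite /knot mul0r mul1r.
  exact: nbhs_left_lt.
rewrite -(fucik_pieces n0 x01); apply: ub_le_sup; first exact: hA.2.
exists x => //=; move: x01; rewrite !in_itv/= /knot mul0r => /andP[/ltW -> /ltW xl].
by rewrite (le_trans xl)//; exact: (@knot_le_pi 1).
Unshelve. all: by end_near. Qed.

Lemma fucik_L2 : L2 u.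
Proof.
apply: (@L2_bounded _ _ m) => [|x Dx]; last exact/fucik_bound/subset_itv_oo_cc.
apply: open_continuous_measurable_fun; first exact: interval_open.
by move=> x; rewrite inE => /(fucik_continuous uf)[].
Qed.

End pieces.
End fucik_pieces.

(** * Fourier coefficients of the eigenfunctions *)

Section fucik_fourier.
Context {R : realType}.
Implicit Types (u v w g h : R -> R) (a b c d p q r x y z s t : R).

Notation mu := (@lebesgue_measure R).
Notation D := (@dom0pi R).

Lemma Rintegral_shift h p l : 0 <= l -> continuous h ->
  \int[mu]_(x in `[p, p + l]) h (x - p) = \int[mu]_(y in `[0, l]) h y.
Proof.
move=> l0 hc; pose F x : R := x - p.
have F1 x : is_derive x 1 F 1.
  by apply: (@is_derive_eq _ _ _ (id - cst p)); rewrite subr0.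
have F'E : derive1 F = cst 1 by apply/funext => x; rewrite derive1E derive_val.
have Fc : continuous F by move=> x; exact: is_derive_continuous.
have := @integration_by_substitution_increasing R F h p (p + l).
have Fa : F p = 0 by rewrite /F subrr.
have Fb : F (p + l) = l by rewrite /F addrAC subrr add0r.
rewrite Fa Fb F'E => H.
rewrite [RHS]/Rintegral H; first 1 last.
- by rewrite lerDl.
- by move=> x y _ _; rewrite /F ltrD2r.
- by move=> x _; exact: cvg_cst.
- exact: is_cvg_cst.
- exact: is_cvg_cst.
- split=> [x _||]; first by have [] := F1 x.
  + exact/cvg_at_right_filter/Fc.
  + exact/cvg_at_left_filter/Fc.
- exact: continuous_subspaceT.
by congr fine; apply: eq_integral => x _; rewrite /= mulr1.
Qed.

Lemma Rintegral_reflect h q l : 0 <= l -> continuous h ->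
  \int[mu]_(x in `[q - l, q]) h (q - x) = \int[mu]_(y in `[0, l]) h y.
Proof.
move=> l0 hc; pose F x : R := q - x.
have F1 x : is_derive x 1 F (- 1).
  by apply: (@is_derive_eq _ _ _ (cst q - id)); rewrite sub0r.
have F'E : derive1 F = cst (- 1) by apply/funext => x; rewrite derive1E derive_val.
have Fc : continuous F by move=> x; exact: is_derive_continuous.
have := @integration_by_substitution_decreasing R F h (q - l) q.
have Fa : F q = 0 by rewrite /F subrr.
have Fb : F (q - l) = l by rewrite /F subKr.
rewrite Fa Fb F'E => H.
rewrite [RHS]/Rintegral H; first 1 last.
- by rewrite gerBl.
- by move=> x y _ _; rewrite /F ltrD2l ltrN2.
- by move=> x _; exact: cvg_cst.
- exact: is_cvg_cst.
- exact: is_cvg_cst.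
- split=> [x _||]; first by have [] := F1 x.
  + exact/cvg_at_right_filter/Fc.
  + exact/cvg_at_left_filter/Fc.
- exact: continuous_subspaceT.
by congr fine; apply: eq_integral => x _; rewrite /= opprK mulr1.
Qed.

Lemma sinD_natmul_pi x (j : nat) : sin (x + j%:R * pi) = sin (x - j%:R * pi).
Proof. by rewrite sinD sinB sin_natmul_pi !mulr0 addr0 subr0. Qed.

Lemma cosD_even_natmul_pi x (i : nat) : ~~ odd i -> cos (x + i%:R * pi) = cos x.
Proof.
move=> /even_halfK <-; elim: i./2 => [|m ih]; first by rewrite mul0r addr0.
by rewrite doubleS -addn2 natrD mulrDl addrA [2%:R * pi]mulr_natl cosD2pi.
Qed.

(* With z = j y and a = j l, the cosine cos(j x) at the point x of the i-th half
   period at which the eigenfunction takes the value [halfwave c s t y]. *)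
Definition fold_cos a z (i : nat) : R :=
  if odd i then cos (z - i.+1%:R * a) else cos (z + i%:R * a).

(** Multiplication by 2 sin a makes the sum telescope, as for the Dirichlet kernel. If m a is a
    multiple of pi, both right-hand sides vanish. *)
Lemma sum_fold_cos a z m :
  2 * sin a * \sum_(0 <= i < m) fold_cos a z i =
  if odd m then sin (z + m%:R * a) - sin (z - m%:R * a)
  else sin (z - a + m%:R * a) - sin (z - a - m%:R * a).
Proof.
elim: m => [|m ih]; first by rewrite big_geq//= mul0r mulr0 addr0 subr0 subrr.
have sin2 x y : 2 * sin x * cos y = sin (y + x) - sin (y - x).
  by rewrite sinD sinB; ring.
rewrite big_nat_recr//= mulrDr ih /fold_cos; case: ifPn => om /=.
  rewrite sin2 -natr1.
  rewrite (_ : z - (m%:R + 1) * a + a = z - m%:R * a); last by ring.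
  rewrite (_ : z - a + (m%:R + 1) * a = z + m%:R * a); last by ring.
  rewrite (_ : z - (m%:R + 1) * a - a = z - a - (m%:R + 1) * a); last by ring.
  by ring.
rewrite sin2 -natr1.
rewrite (_ : z + m%:R * a + a = z + (m%:R + 1) * a); last by ring.
rewrite (_ : z + m%:R * a - a = z - a + m%:R * a); last by ring.
rewrite (_ : z - a - m%:R * a = z - (m%:R + 1) * a); last by ring.
by ring.
Qed.

Lemma sum_fold_cos_eq0 n j a z : n%:R * a = j%:R * pi -> sin a != 0 ->
  \sum_(0 <= i < n) fold_cos a z i = 0.
Proof.
move=> na sa; have sa2 : 2 * sin a != 0 by rewrite mulf_neq0.
apply: (mulfI sa2); rewrite mulr0 sum_fold_cos na !sinD_natmul_pi !subrr.
by case: ifP.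
Qed.

Lemma sin_ndvd n j a : (0 < n)%N -> ~~ (n %| j)%N -> n%:R * a = j%:R * pi -> sin a != 0.
Proof.
move=> n0 nj na; have n0' : 0 < n%:R :> R by rewrite ltr0n.
(* The residue of a modulo pi: as n does not divide j, it lies strictly between 0 and pi. *)
pose b : R := (j %% n)%:R * pi / n%:R.
have aE : a = b + (j %/ n)%:R * pi.
  apply: (mulfI (lt0r_neq0 n0')); rewrite na [RHS]mulrDr /b [n%:R * (_ / _)]mulrC divfK ?gt_eqF//.
  by rewrite mulrA -natrM -mulrDl -natrD {1}(divn_eq j n) addnC mulnC.
have cn0 : cos ((j %/ n)%:R * pi) != 0 :> R.
  apply/eqP => c0; have := cos2Dsin2 ((j %/ n)%:R * pi : R).
  by rewrite c0 sin_natmul_pi expr0n addr0 => /eqP; rewrite eq_sym oner_eq0.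
rewrite aE sinD sin_natmul_pi mulr0 addr0 mulf_neq0// gt_eqF//.
rewrite sin_gt0_pi// /b divr_gt0 ?mulr_gt0 ?pi_gt0// ?ltr0n ?lt0n//=.
by rewrite ltr_pdivrMr// mulrC ltr_pM2l ?pi_gt0// ltr_nat ltn_mod.
Qed.

(** The shifts i k pi for even i, and (i + 1) k pi for odd i, are multiples of 2 pi, so all half
    periods contribute equally. *)
Lemma fold_cos_dvd k z i : fold_cos (k%:R * pi) z i = cos z.
Proof.
rewrite /fold_cos; case: ifPn => oi.
  rewrite mulrA -natrM -[in LHS]cosN opprB addrC cosD_even_natmul_pi ?cosN//.
  by rewrite oddM/= oi.
by rewrite mulrA -natrM cosD_even_natmul_pi// oddM (negbTE oi).
Qed.

Section coefficients.
Variables (n : nat) (s t c : R) (u u1 : R -> R).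
Hypothesis n0 : (0 < n)%N.
Hypothesis s0 : 0 < s.
Hypothesis t0 : 0 < t.
Hypothesis c0 : 0 < c.
Let l := pi / (2 * s) + pi / (2 * t).
Hypothesis nl : n%:R * l = pi.
Hypothesis uf : fucik_on (s ^+ 2) (t ^+ 2) u u1 0 pi.
Hypothesis u0 : u x @[x --> 0^'+] --> c.
Hypothesis u10 : u1 x @[x --> 0^'+] --> 0.
Hypothesis upi : u x @[x --> pi^'-] --> u pi.
Hypothesis u0E : u 0 = c.

Let l0 : 0 < l.
Proof. by rewrite addr_gt0// divr_gt0 ?pi_gt0 ?mulr_gt0. Qed.

Let uL2 : L2 u. Proof. exact: (fucik_L2 s0 t0 c0 nl uf u0 u10 upi u0E). Qed.

Let U := halfwave c s t.

Let integ_u j : mu.-integrable D (EFin \o (fun x => u x * cos (j%:R * x))).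
Proof. by apply: L2_integrableM => //; exact: L2_cosM. Qed.

Let continuous_piece b d (e : R) : continuous (fun y => U y * cos (b * (d + e * y))).
Proof.
move=> y; apply: cvgM; first exact: continuous_halfwave.
apply: (@continuous_comp _ _ _ (fun y => b * (d + e * y)) cos); last exact: continuous_cos.
apply: cvgM; first exact: cvg_cst.
by apply: cvgD; [exact: cvg_cst|apply: cvgM; [exact: cvg_cst|exact: cvg_id]].
Qed.

Let integral_piece j i : (i < n)%N ->
  \int[mu]_(x in `]i%:R * l, i.+1%:R * l[) (u x * cos (j%:R * x)) =
  \int[mu]_(y in `[0, l]) (U y * fold_cos (j%:R * l) (j%:R * y) i).
Proof.
move=> ni; transitivity (\int[mu]_(x in `]i%:R * l, i.+1%:R * l[) ((if odd i then
    U (i.+1%:R * l - x) else U (x - i%:R * l)) * cos (j%:R * x))).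
  apply: eq_Rintegral => x; rewrite inE/= => xi.
  by rewrite (fucik_pieces s0 t0 c0 nl uf u0 u10 ni xi).
have iE : i.+1%:R * l = i%:R * l + l by rewrite -natr1 mulrDl mul1r.
rewrite /fold_cos; case: (odd i).
  pose h y : R := U y * cos (j%:R * (i.+1%:R * l + (-1) * y)).
  have hE x : U (i.+1%:R * l - x) * cos (j%:R * x) = h (i.+1%:R * l - x).
    by rewrite /h mulN1r subKr.
  under eq_Rintegral do rewrite hE.
  have hc : continuous h by exact: continuous_piece.
  rewrite Rintegral_itv_oo_cc; last first.
    apply/continuous_integrable/continuous_subspaceT => x.
    apply: (@continuous_comp _ _ _ (fun x => i.+1%:R * l - x) h); last exact: hc.
    by apply: cvgB; [exact: cvg_cst|exact: cvg_id].
  rewrite (_ : i%:R * l = i.+1%:R * l - l); last by rewrite iE addrK.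
  rewrite Rintegral_reflect ?ltW//; apply: eq_Rintegral => y _.
  by rewrite /h -cosN; congr (_ * cos _); ring.
pose h y : R := U y * cos (j%:R * (i%:R * l + 1 * y)).
have hE x : U (x - i%:R * l) * cos (j%:R * x) = h (x - i%:R * l).
  by rewrite /h mul1r [i%:R * l + _]addrC subrK.
under eq_Rintegral do rewrite hE.
have hc : continuous h by exact: continuous_piece.
rewrite Rintegral_itv_oo_cc; last first.
  apply/continuous_integrable/continuous_subspaceT => x.
  apply: (@continuous_comp _ _ _ (fun x => x - i%:R * l) h); last exact: hc.
  by apply: cvgB; [exact: cvg_id|exact: cvg_cst].
rewrite iE Rintegral_shift ?ltW//; apply: eq_Rintegral => y _.
by rewrite /h; congr (_ * cos _); ring.
Qed.

Let integral_prefix j m : (m <= n)%N ->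
  \int[mu]_(x in `]0, m%:R * l[) (u x * cos (j%:R * x)) =
  \sum_(0 <= i < m) \int[mu]_(y in `[0, l]) (U y * fold_cos (j%:R * l) (j%:R * y) i).
Proof.
elim: m => [_|m ih mn].
  by rewrite mul0r big_geq// set_itv_ge ?Rintegral_set0// bnd_simp ltxx.
rewrite big_nat_recr//= -(ih (ltnW mn)) -integral_piece//.
have sub r : r <= pi -> mu.-integrable `]0, r[ (EFin \o (fun x => u x * cos (j%:R * x))).
  move=> rpi; apply: integrableS (integ_u j) => //.
  by apply: subset_itvl; rewrite bnd_simp.
have knot_pi i : (i <= n)%N -> i%:R * l <= pi by rewrite -nl ler_pM2r// ler_nat.
have := @Rintegral_itvB R (fun x => u x * cos (j%:R * x)) (BRight 0)
  (BLeft (m.+1%:R * l)) (m%:R * l) (sub _ (knot_pi _ mn)).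
have ml0 : 0 <= m%:R * l by rewrite mulr_ge0// ltW.
rewrite !bnd_simp ml0 => /(_ isT).
rewrite ltr_pM2r// ltr_nat ltnSn => /(_ isT) <-.
by rewrite [X in _ = X + _]Rintegral_itv_bndo_bndc ?sub ?knot_pi ?(ltnW mn)// addrC subrK.
Qed.

(** All n half periods are folded onto [0, l], where u becomes one and the same half wave and only
    the cosine factors differ. *)
Lemma fucik_coef_sum j :
  \int[mu]_(x in D) (u x * cos (j%:R * x)) =
  \int[mu]_(y in `[0, l]) (U y * \sum_(0 <= i < n) fold_cos (j%:R * l) (j%:R * y) i).
Proof.
rewrite /dom0pi -{1}nl integral_prefix//.
have fc i : continuous (fun y => U y * fold_cos (j%:R * l) (j%:R * y) i).
  rewrite /fold_cos; case: (odd i).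
    rewrite [X in continuous X](_ : _ =
      (fun y => U y * cos (j%:R * (- (i.+1%:R * l) + 1 * y)))).
      exact: continuous_piece.
    by apply/funext => y; congr (_ * cos _); ring.
  rewrite [X in continuous X](_ : _ = (fun y => U y * cos (j%:R * (i%:R * l + 1 * y)))).
    exact: continuous_piece.
  by apply/funext => y; congr (_ * cos _); ring.
have sc m : continuous (fun y =>
    \sum_(0 <= i < m) U y * fold_cos (j%:R * l) (j%:R * y) i).
  elim: m => [|m ih].
    by under eq_fun do rewrite big_geq//; exact: cst_continuous.
  under eq_fun do rewrite big_nat_recr//=.
  by move=> y; apply: cvgD; [exact: ih|exact: fc].
under [RHS]eq_Rintegral do rewrite mulr_sumr.
elim: (n) => [|m ih].
  rewrite big_geq//; under eq_Rintegral do rewrite big_geq//.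
  by rewrite Rintegral_cst// mul0r.
rewrite big_nat_recr//= ih.
under [RHS]eq_Rintegral do rewrite big_nat_recr//=.
rewrite RintegralD//.
- exact/continuous_integrable/continuous_subspaceT.
- exact/continuous_integrable/continuous_subspaceT.
Qed.

Lemma fucik_coef_ndvd j : ~~ (n %| j)%N ->
  \int[mu]_(x in D) (u x * cos (j%:R * x)) = 0.
Proof.
move=> nj; have nj' : n%:R * (j%:R * l) = j%:R * pi by rewrite mulrCA nl.
rewrite fucik_coef_sum; under eq_Rintegral => y _.
  rewrite (sum_fold_cos_eq0 _ nj' (sin_ndvd n0 nj nj')) mulr0; over.
by rewrite Rintegral_cst// mul0r.
Qed.

Lemma fucik_coef_dvd k :
  \int[mu]_(x in D) (u x * cos ((k * n)%:R * x)) =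
  n%:R * \int[mu]_(y in `[0, l]) (U y * cos ((k * n)%:R * y)).
Proof.
rewrite fucik_coef_sum -RintegralZl//; last first.
  apply/continuous_integrable/continuous_subspaceT.
  by move=> y; apply: cvgM; [exact: continuous_halfwave|exact: continuous_cosM].
apply: eq_Rintegral => y _; rewrite [in _ * l]natrM -mulrA nl.
under eq_bigr do rewrite fold_cos_dvd.
by rewrite sumr_const_nat subn0 -[cos _ *+ n]mulr_natl mulrCA.
Qed.

End coefficients.
End fucik_fourier.

(** * Cosine integrals of the half wave and their estimates *)

Section halfwave_coefficients.
Context {R : realType}.
Implicit Types (c s t x y K N : R).

Notation mu := (@lebesgue_measure R).

Lemma continuous_Rintegral_le (f g : R -> R) x y : continuous f -> continuous g ->
  (forall z, z \in `[x, y] -> f z <= g z) ->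
  \int[mu]_(z in `[x, y]) f z <= \int[mu]_(z in `[x, y]) g z.
Proof.
by move=> fc gc fg; apply: le_Rintegral => //;
  exact/continuous_integrable/continuous_subspaceT.
Qed.

Lemma continuous_shift_cos c s x : continuous (fun y => c * cos (s * (y - x))).
Proof. by move=> y; exact: is_derive_continuous (is_derive_shift_cos c s x y). Qed.

Lemma continuous_shift_sin c s x : continuous (fun y => c * sin (s * (y - x))).
Proof. by move=> y; exact: is_derive_continuous (is_derive_shift_sin c s x y). Qed.

Lemma is_derive_mul (f g : R -> R) x (df dg : R) :
  is_derive x 1 f df -> is_derive x 1 g dg ->
  is_derive x 1 (fun y => f y * g y) (f x * dg + g x * df).
Proof. exact: is_deriveM. Qed.

Lemma is_derive_add (f g : R -> R) x (df dg : R) :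
  is_derive x 1 f df -> is_derive x 1 g dg ->
  is_derive x 1 (fun y => f y + g y) (df + dg).
Proof. exact: is_deriveD. Qed.

Lemma is_derive_sub (f g : R -> R) x (df dg : R) :
  is_derive x 1 f df -> is_derive x 1 g dg ->
  is_derive x 1 (fun y => f y - g y) (df - dg).
Proof. exact: is_deriveB. Qed.

Section bounds.
Variables (n : nat) (c s t : R).
Hypothesis n0 : (0 < n)%N.
Hypothesis s0 : 0 < s.
Hypothesis t0 : 0 < t.
Hypothesis c0 : 0 < c.
Let th := pi / (2 * s).
Let l := th + pi / (2 * t).
Hypothesis nl : n%:R * l = pi.

Let th0 : 0 < th. Proof. by rewrite divr_gt0 ?pi_gt0 ?mulr_gt0. Qed.

Let thl : th < l. Proof. by rewrite ltrDl divr_gt0 ?pi_gt0 ?mulr_gt0. Qed.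

Let sth : s * th = pi / 2. Proof. by rewrite mulr_div2l// gt_eqF. Qed.

Let tth : t * (l - th) = pi / 2.
Proof. by rewrite /l addrAC subrr add0r mulr_div2l// gt_eqF. Qed.

(** This is J of the overview; [I1], which is I there, and [I2] are the contributions of the
    positive and the negative part. *)
Definition wave_coef c s t (K : R) :=
  \int[mu]_(y in `[0, pi / (2 * s) + pi / (2 * t)]) (halfwave c s t y * cos (K * y)).

Let I1 K := \int[mu]_(y in `[0, th]) (c * cos (s * (y - 0)) * cos (K * y)).
Let I2 K := \int[mu]_(y in `[th, l]) (- (c * s / t) * sin (t * (y - th)) * cos (K * y)).

Let c1 K : continuous (fun y => c * cos (s * (y - 0)) * cos (K * y)).
Proof. by move=> y; apply: cvgM; [exact: continuous_shift_cos|exact: continuous_cosM]. Qed.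

Let c2 K : continuous (fun y => - (c * s / t) * sin (t * (y - th)) * cos (K * y)).
Proof. by move=> y; apply: cvgM; [exact: continuous_shift_sin|exact: continuous_cosM]. Qed.

Let wave_coef_split K : wave_coef c s t K = I1 K + I2 K.
Proof.
have hc : continuous (fun y => halfwave c s t y * cos (K * y)).
  by move=> y; apply: cvgM; [exact: continuous_halfwave|exact: continuous_cosM].
have hi x y : mu.-integrable `[x, y] (EFin \o (fun y => halfwave c s t y * cos (K * y))).
  exact/continuous_integrable/continuous_subspaceT.
have := @Rintegral_itvB R (fun y => halfwave c s t y * cos (K * y)) (BLeft 0)
  (BRight l) th (hi _ _).
rewrite !bnd_simp (ltW th0) (ltW thl) => /(_ isT isT) E.
rewrite /wave_coef -/th -/l -[LHS](subrK (\int[mu]_(y in `[0, th])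
  (halfwave c s t y * cos (K * y)))) E addrC; congr (_ + _).
  apply: eq_Rintegral => y; rewrite inE/= in_itv/= => /andP[_ yth].
  by rewrite halfwave_le// subr0.
rewrite Rintegral_itv_obnd_cbnd; last first.
  by apply: integrableS (hi th l) => //; exact: subset_itv_oc_cc.
apply: eq_Rintegral => y; rewrite inE/= in_itv/= => /andP[thy _].
by rewrite halfwave_ge.
Qed.

Let I1E K : (s ^+ 2 - K ^+ 2) * I1 K = c * s * cos (K * th).
Proof.
rewrite /I1 -RintegralZl//; last exact/continuous_integrable/continuous_subspaceT.
(* Up to the factor c, the Wronskian of cos(s y) and cos(K y). The factors 1 and the shift by 0 fit
   the form of the derivative lemmas. *)
pose F y := c * (s * (1 * sin (s * (y - 0)) * cos (K * y))
  - K * (1 * cos (s * (y - 0)) * sin (K * y))).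
have dF y : is_derive y 1 F ((s ^+ 2 - K ^+ 2) * (c * cos (s * (y - 0)) * cos (K * y))).
  have d1 := is_derive_mul (is_derive_shift_sin 1 s 0 y) (is_derive_cosM K y).
  have d2 := is_derive_mul (is_derive_shift_cos 1 s 0 y) (is_derive_sinM K y).
  have d3 := is_derive_sub (is_derive_scale s d1) (is_derive_scale K d2).
  by apply: (is_derive_eq (is_derive_scale c d3)); ring.
have cF : continuous (fun y => (s ^+ 2 - K ^+ 2) * (c * cos (s * (y - 0)) * cos (K * y))).
  by move=> y; apply: cvgM; [exact: cvg_cst|exact: c1].
rewrite (Rintegral_derive (ltW th0) cF dF).
by rewrite /F !subr0 sth sin_pihalf cos_pihalf !mulr0 sin0 cos0; ring.
Qed.

(** The assumption removes the boundary term at l, and the one at th is opposite to that in [I1E];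
    this cancellation yields [wave_coefE]. *)
Let I2E K : sin (K * l) = 0 -> (t ^+ 2 - K ^+ 2) * I2 K = - (c * s * cos (K * th)).
Proof.
move=> Kl; rewrite /I2 -RintegralZl//; last exact/continuous_integrable/continuous_subspaceT.
pose F y := (c * s / t) * (t * (1 * cos (t * (y - th)) * cos (K * y))
  + K * (1 * sin (t * (y - th)) * sin (K * y))).
have dF y : is_derive y 1 F
    ((t ^+ 2 - K ^+ 2) * (- (c * s / t) * sin (t * (y - th)) * cos (K * y))).
  have d1 := is_derive_mul (is_derive_shift_cos 1 t th y) (is_derive_cosM K y).
  have d2 := is_derive_mul (is_derive_shift_sin 1 t th y) (is_derive_sinM K y).
  have d3 := is_derive_add (is_derive_scale t d1) (is_derive_scale K d2).
  apply: (is_derive_eq (is_derive_scale (c * s / t) d3)).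
  by move: (c * s / t) => *; ring.
have cF : continuous (fun y =>
    (t ^+ 2 - K ^+ 2) * (- (c * s / t) * sin (t * (y - th)) * cos (K * y))).
  by move=> y; apply: cvgM; [exact: cvg_cst|exact: c2].
rewrite (Rintegral_derive (ltW thl) cF dF).
rewrite /F subrr tth sin_pihalf cos_pihalf Kl !mulr0 cos0 sin0.
by rewrite !(mulr0, mul0r, addr0, sub0r, mul1r) mulrA divfK// gt_eqF.
Qed.

(* Stated without division: s may well be equal to K, and s = t = K at the center
   of the Fucik curve. *)
Lemma wave_coefE K : sin (K * l) = 0 ->
  (K ^+ 2 - t ^+ 2) * wave_coef c s t K = (s ^+ 2 - t ^+ 2) * I1 K.
Proof.
move=> Kl; rewrite wave_coef_split.
have := I1E K; have := I2E Kl; move: (I1 K) (I2 K) (c * s * _) => x y z h1 h2.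
rewrite (_ : _ * (x + y) = (K ^+ 2 - t ^+ 2) * x - (t ^+ 2 - K ^+ 2) * y); last by ring.
by rewrite h1 -h2; ring.
Qed.

Let cos_ge0_th y : y \in `[0, th] -> 0 <= cos (s * (y - 0)).
Proof.
rewrite in_itv/= subr0 => /andP[y0 yth]; apply: cos_ge0_pihalf; apply/andP; split.
  by rewrite (@le_trans _ _ 0)// ?mulr_ge0 ?(ltW s0)// oppr_le0 divr_ge0 ?pi_ge0.
by rewrite -sth ler_pM2l.
Qed.

Let norm_I1 K : `|I1 K| <= c / s.
Proof.
apply: le_trans (le_normr_Rintegral _ _) _ => //.
  exact/continuous_integrable/continuous_subspaceT.
have cn : continuous (fun y => `|c * cos (s * (y - 0)) * cos (K * y)|).
  by move=> y; apply: cvg_norm; exact: c1.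
apply: (@le_trans _ _ (\int[mu]_(y in `[0, th]) (c * cos (s * (y - 0))))).
  apply: continuous_Rintegral_le => //; first exact: continuous_shift_cos.
  move=> y yth; rewrite normrM ger0_norm; last by rewrite mulr_ge0 ?(ltW c0)// cos_ge0_th.
  by rewrite ler_piMr ?cos_max// mulr_ge0 ?(ltW c0)// cos_ge0_th.
pose F y := c / s * (1 * sin (s * (y - 0))).
have dF y : is_derive y 1 F (c * cos (s * (y - 0))).
  apply: (is_derive_eq (is_derive_scale (c / s) (is_derive_shift_sin 1 s 0 y))).
  by field; rewrite gt_eqF.
rewrite (Rintegral_derive (ltW th0) _ dF); last exact: continuous_shift_cos.
by rewrite /F !subr0 sth sin_pihalf mulr0 sin0 !mulr0 subr0 !mulr1.
Qed.

(* cos(n y) >= cos(s y) on [0, th] because n <= s. *)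
Let I1_ge : n%:R <= s -> c * pi / (4 * s) <= I1 n%:R.
Proof.
move=> ns.
pose f y := c * (2^-1 + 2^-1 * cos (2 * s * y)).
have cf : continuous f.
  move=> y; apply: cvgM; first exact: cvg_cst.
  apply: cvgD; first exact: cvg_cst.
  by apply: cvgM; [exact: cvg_cst|exact: continuous_cosM].
apply: (@le_trans _ _ (\int[mu]_(y in `[0, th]) f y)); last first.
  apply: continuous_Rintegral_le => // y yth.
  have cy := cos_ge0_th yth; move: yth; rewrite in_itv/= => /andP[y0 yth].
  rewrite subr0 in cy *.
  have -> : f y = c * cos (s * y) * cos (s * y).
    by rewrite /f -[2 * s * y]mulrA [2 * (s * y)]mulr_natl cos_mulr2n; field.
  rewrite ler_wpM2l// ?mulr_ge0 ?(ltW c0)//.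
  have le_cos x z : 0 <= x -> x <= z -> z <= pi -> cos z <= cos x.
    move=> x0; rewrite le_eqVlt => /predU1P[->//|xz] zpi.
    by rewrite ltW// ltr_cos// in_itv/= ?x0 ?zpi ?(ltW (lt_le_trans xz zpi))
      ?(ltW (le_lt_trans x0 xz)).
  apply: le_cos; first by rewrite mulr_ge0.
    by rewrite ler_wpM2r.
  apply: (@le_trans _ _ (pi / 2)); first by rewrite -sth ler_pM2l.
  by rewrite ler_pdivrMr// ler_peMr ?pi_ge0// ler1n.
pose F y := c * (2^-1 * y + (4 * s)^-1 * sin (2 * s * y)).
have dF y : is_derive y 1 F (f y).
  have d := is_derive_add (is_derive_mull 2^-1 y)
    (is_derive_scale (4 * s)^-1 (is_derive_sinM (2 * s) y)).
  by apply: (is_derive_eq (is_derive_scale c d)); rewrite /f; field; rewrite gt_eqF.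
rewrite (Rintegral_derive (ltW th0) cf dF) /F !mulr0 sin0 mulr0 addr0 mulr0 subr0.
rewrite -[2 * s * th]mulrA sth [2 * _]mulrC divfK// sinpi mulr0 addr0 /th.
rewrite le_eqVlt; apply/orP; left; apply/eqP.
by move: (pi) => p; field; rewrite gt_eqF.
Qed.

Hypothesis st : t <= s.

Let N : R := n%:R.

Let N0 : 0 < N. Proof. by rewrite ltr0n. Qed.

(** N is the harmonic mean of s and t: it lies between them, and N = 2 s t / (s + t) < 2 t. *)
Let period_harmonic : N * (s + t) = 2 * s * t.
Proof.
have s1 : s != 0 by rewrite gt_eqF.
have t1 : t != 0 by rewrite gt_eqF.
have : pi * (N * (s + t) / (2 * s * t)) = pi * 1.
  rewrite mulr1 -[RHS]nl /l /th -/N; move: (pi) => p; field.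
  by rewrite s1 t1.
move/(mulfI (lt0r_neq0 (pi_gt0 R)))/(congr1 ( *%R^~ (2 * s * t))).
by rewrite mul1r divfK// !mulf_neq0.
Qed.

Let tN : t <= N.
Proof.
rewrite -(ler_pM2r (addr_gt0 s0 t0)) period_harmonic.
by have := ler_wpM2l (ltW t0) st; nra.
Qed.

Let Ns : N <= s.
Proof.
rewrite -(ler_pM2r (addr_gt0 s0 t0)) period_harmonic.
by have := ler_wpM2l (ltW s0) st; nra.
Qed.

Let N2t : N < 2 * t.
Proof.
rewrite -(ltr_pM2r (addr_gt0 s0 t0)) period_harmonic.
by have := mulr_gt0 t0 t0; nra.
Qed.

Let sin_l k : sin ((k * n)%:R * l) = 0.
Proof. by rewrite natrM -mulrA nl sin_natmul_pi. Qed.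

Let wave_coefN_ge : (s ^+ 2 - t ^+ 2) * (c * pi / (4 * s)) <=
  (N ^+ 2 - t ^+ 2) * wave_coef c s t N.
Proof.
have := sin_l 1; rewrite mul1n => /wave_coefE ->.
by rewrite ler_wpM2l ?I1_ge// subr_ge0 lerXn2r ?nnegrE ?(ltW s0) ?(ltW t0).
Qed.

Let t_eqN : t = N -> s = N.
Proof.
move=> tE; apply: (mulIf (lt0r_neq0 N0)).
by have := period_harmonic; rewrite tE; nra.
Qed.

(** As c = t / s, the lower bound for the positive part is (1 - t^2/s^2) t pi / 4, which is at least
    (1 - t^2/N^2) t pi / 4 because N <= s. Cancelling N^2 - t^2 gives t pi / (4 N) >= pi / 8, as t >
    N/2. At t = N nothing can be cancelled; then s = t and both parts of the integral are estimated
    directly. *)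
Lemma wave_coef_ge : c * s / t = 1 -> pi / 8 <= N * wave_coef c s t N.
Proof.
move=> cst; have cE : c = t / s.
  by apply: (mulIf (lt0r_neq0 s0)); rewrite divfK ?gt_eqF// -[RHS]mul1r -cst divfK ?gt_eqF.
have s1 : s != 0 by rewrite gt_eqF.
have [tE|tneN] := eqVneq t N.
  have sE := t_eqN tE; rewrite wave_coef_split.
  have cE1 : c = 1 by rewrite cE tE sE divff// gt_eqF.
  have I20 : 0 <= I2 N.
    have Nth : N * th = pi / 2 by rewrite -[N]sE sth.
    apply: Rintegral_ge0 => y _; rewrite cst tE mulrBr Nth sinBpihalf mulN1r opprK.
    by rewrite -expr2 sqr_ge0.
  apply: (@le_trans _ _ (N * I1 N)); last by rewrite ler_pM2l// lerDl.
  apply: (@le_trans _ _ (N * (c * pi / (4 * s)))); last by rewrite ler_pM2l// I1_ge.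
  rewrite cE1 sE (_ : N * _ = pi / 4).
    by rewrite ler_pM2l ?pi_gt0// lef_pV2 ?posrE// ler_nat.
  by move: (pi) => p; field; rewrite gt_eqF.
have {tneN}tN' : t < N by rewrite lt_neqAle tneN.
have Nt2 : 0 < N ^+ 2 - t ^+ 2 by rewrite subr_gt0 ltrXn2r ?nnegrE ?(ltW t0) ?(ltW N0).
apply: (@le_trans _ _ (t * pi / (4 * N))).
  have -> : t * pi / (4 * N) = pi / 8 + (2 * t - N) * pi / (8 * N).
    by move: (pi) => p; field; rewrite gt_eqF.
  by rewrite lerDl divr_ge0 ?mulr_ge0 ?pi_ge0 ?subr_ge0 ?(ltW N2t) ?(ltW N0).
have -> : t * pi / (4 * N) = N * (t * pi / (4 * N ^+ 2)).
  by move: (pi) => p; field; rewrite gt_eqF.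
rewrite ler_pM2l// -(ler_pM2l Nt2); apply: le_trans wave_coefN_ge.
have -> : (s ^+ 2 - t ^+ 2) * (c * pi / (4 * s)) =
    (1 - t ^+ 2 / s ^+ 2) * (t * pi / 4).
  by rewrite cE; move: (pi) => p; field.
have -> : (N ^+ 2 - t ^+ 2) * (t * pi / (4 * N ^+ 2)) =
    (1 - t ^+ 2 / N ^+ 2) * (t * pi / 4).
  by move: (pi) => p; field; rewrite gt_eqF.
rewrite ler_wpM2r ?divr_ge0 ?mulr_ge0 ?pi_ge0 ?(ltW t0)// lerD2l lerN2.
by rewrite ler_wpM2l ?sqr_ge0// lef_pV2 ?posrE ?exprn_gt0// lerXn2r ?nnegrE ?(ltW s0) ?(ltW N0).
Qed.

Lemma wave_coef_offdiag k : c * s / t = 1 -> (2 <= k)%N ->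
  `|wave_coef c s t (k * n)%:R| <=
  3 / pi / (k%:R ^+ 2 - 4^-1) * wave_coef c s t N.
Proof.
move=> cst k2; have k2' : 2 <= k%:R :> R by rewrite ler_nat.
have kk : 4 <= k%:R ^+ 2 :> R by rewrite -[4]/((2 * 2)%:R) natrM -expr2 lerXn2r ?nnegrE.
have kk0 : 0 < k%:R ^+ 2 - 4^-1 :> R by lra.
have J0 : 0 <= wave_coef c s t N.
  rewrite -(pmulr_rge0 _ N0) (le_trans _ (wave_coef_ge cst))// divr_ge0 ?pi_ge0//.
have JE := wave_coefE (sin_l k).
have KE : (k * n)%:R = k%:R * N :> R by rewrite natrM.
have Kt : 0 < (k%:R * N) ^+ 2 - t ^+ 2.
  rewrite subr_gt0 ltrXn2r ?nnegrE ?mulr_ge0 ?(ltW t0) ?(ltW N0)//.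
  by rewrite (le_lt_trans tN)// ltr_pMl// (lt_le_trans _ k2')// ltr1n.
(* The difference of the two sides factors as (k^2 - 1) (4 t^2 - N^2) / 4, which would vanish at the
   excluded end t = N/2. *)
have ratio : (N ^+ 2 - t ^+ 2) * (k%:R ^+ 2 - 4^-1) <=
    3 / 4 * ((k%:R * N) ^+ 2 - t ^+ 2).
  rewrite -subr_ge0 (_ : _ - _ = (k%:R ^+ 2 - 1) * ((2 * t) ^+ 2 - N ^+ 2) / 4); last by field.
  rewrite divr_ge0// mulr_ge0 ?subr_ge0//; first by lra.
  by rewrite lerXn2r ?nnegrE ?mulr_ge0 ?(ltW t0) ?(ltW N0) ?(ltW N2t).
have st2 : 0 <= s ^+ 2 - t ^+ 2 by rewrite subr_ge0 lerXn2r ?nnegrE ?(ltW s0) ?(ltW t0).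
(* The factor s^2 - t^2 is common to the identities at k N and at N, so comparing c / s with c pi /
   (4 s) never divides by it. *)
have JK : `|wave_coef c s t (k * n)%:R| * ((k%:R * N) ^+ 2 - t ^+ 2) * (pi / 4) <=
    (N ^+ 2 - t ^+ 2) * wave_coef c s t N.
  apply: le_trans wave_coefN_ge.
  rewrite -(gtr0_norm Kt) -normrM mulrC -KE [wave_coef _ _ _ _ * _]mulrC JE normrM.
  rewrite (ger0_norm st2) mulrCA ler_wpM2l//.
  apply: (@le_trans _ _ (pi / 4 * (c / s))); first by rewrite ler_pM2l ?norm_I1// divr_gt0 ?pi_gt0.
  rewrite le_eqVlt; apply/orP; left; apply/eqP; move: (pi) => p; field.
  by rewrite gt_eqF.
rewrite mulrAC ler_pdivlMr// [3 / pi * _]mulrAC ler_pdivlMr ?pi_gt0//.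
rewrite -(ler_pM2r Kt); move: JK (ler_wpM2r J0 ratio) (ltW kk0).
move: (wave_coef c s t _) (wave_coef c s t N) ((k%:R * N) ^+ 2 - t ^+ 2)
  (N ^+ 2 - t ^+ 2) (k%:R ^+ 2 - 4^-1).
move=> A B C E G; move: (`|A|) (pi) => {}A p h1 h2 h3.
have := ler_wpM2r h3 h1; lra.
Qed.

End bounds.

End halfwave_coefficients.

(** * Fucik systems *)

Section fucik_systems.
Context {R : realType}.
Implicit Types (u v w : R -> R) (c s t : R).

Notation mu := (@lebesgue_measure R).
Notation D := (@dom0pi R).

(** Under y -> l - y the cosine only picks up the factor cos(k pi), because K l = k pi. For k = 1
    the total sign is +, so the diagonal stays positive. *)
Lemma wave_coef_refl (n k : nat) c s t : 0 < s -> 0 < t ->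
  n%:R * (pi / (2 * s) + pi / (2 * t)) = pi ->
  wave_coef c s t (k * n)%:R =
  - cos (k%:R * pi) * wave_coef (c * s / t) t s (k * n)%:R.
Proof.
move=> s0 t0; rewrite /wave_coef [pi / (2 * t) + _]addrC.
set l := pi / (2 * s) + pi / (2 * t) => nl.
have l0 : 0 <= l by rewrite addr_ge0// divr_ge0 ?pi_ge0 ?mulr_ge0 ?ltW.
set K : R := (k * n)%:R.
have Kl : K * l = k%:R * pi by rewrite /K natrM -mulrA nl.
have hc : continuous (fun y => halfwave c s t y * cos (K * y)).
  by move=> y; apply: cvgM; [exact: continuous_halfwave|exact: continuous_cosM].
rewrite -(Rintegral_reflect l l0 hc) subrr -RintegralZl//; last first.
  apply/continuous_integrable/continuous_subspaceT.
  by move=> y; apply: cvgM; [exact: continuous_halfwave|exact: continuous_cosM].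
apply: eq_Rintegral => y _; rewrite -halfwave_refl// mulrBr Kl cosB sin_natmul_pi.
by ring.
Qed.

(* The constant 3/pi is 4/pi * 3/4, where 3/4 / (k^2 - 1/4) is the maximum over
   t in [1/2, 1] of (1 - t^2) / (k^2 - t^2). *)
Definition wave_ratio (k : nat) : R :=
  if (2 <= k)%N then 3 / pi / (k%:R ^+ 2 - 4^-1) else 0.

Lemma wave_ratio_ge0 k : 0 <= wave_ratio k.
Proof.
rewrite /wave_ratio; case: ifPn => // k2.
rewrite !divr_ge0 ?pi_ge0// subr_ge0.
have k1 : 1 <= k%:R :> R by rewrite ler1n ltnW.
by have := ler_wpM2l (ltW (lt_le_trans ltr01 k1)) k1; nra.
Qed.

Lemma sum_wave_ratio N : \sum_(2 <= k < N) wave_ratio k <= 2 / pi.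
Proof.
(* Telescoping: 1 / (k^2 - 1/4) = 1 / (k - 1/2) - 1 / (k + 1/2), starting from 1 / (3/2) = 2/3. *)
have E m : \sum_(2 <= k < m.+2) wave_ratio k = 3 / pi * (2 / 3 - (m%:R + 3 / 2)^-1).
  elim: m => [|m ih].
    by rewrite big_geq// add0r invf_div subrr mulr0.
  rewrite big_nat_recr//= ih; have m0 : 0 <= m%:R :> R by [].
  have -> : wave_ratio m.+2 = 3 / pi * ((m%:R + 3 / 2)^-1 - (m.+1%:R + 3 / 2)^-1).
    rewrite /wave_ratio/= -(natr1 m.+1) -(natr1 m); congr (_ * _).
    by move: (m%:R) m0 => x x0; field; rewrite !gt_eqF//; nra.
  by rewrite -mulrDr; congr (_ * _); ring.
have [|N2] := leqP N 2; first by move=> N2; rewrite big_geq// divr_ge0 ?pi_ge0.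
rewrite -(subnK (ltnW N2)) addn2 E.
have : 0 <= ((N - 2)%:R + 3 / 2)^-1 :> R by rewrite invr_ge0 addr_ge0.
have : 0 < pi^-1 :> R by rewrite invr_gt0 pi_gt0.
by move: (pi^-1) ((N - 2)%:R + 3 / 2)^-1 => p q p0 q0; nra.
Qed.

(** Strictness is what makes the ratio 2 / pi less than 1; equality would force cos 1 = cos(pi / 2)
    = 0. *)
Lemma pi_gt2 : 2 < pi :> R.
Proof.
rewrite lt_neqAle pi_ge2 andbT; apply/eqP => pi2.
have := @cos1_gt0 R; rewrite (_ : 1 = pi / 2); first by rewrite cos_pihalf ltxx.
by rewrite -pi2 divff.
Qed.

(** The larger of the amplitudes c and c s / t is 1: the second if t <= s, the first otherwise. In
    the latter case the reflected wave, with s and t exchanged, is normalized as in the former. *)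
Lemma wave_coef_estimates (n : nat) c s t : (0 < n)%N -> 0 < s -> 0 < t -> 0 < c ->
  n%:R * (pi / (2 * s) + pi / (2 * t)) = pi -> Num.max c (c * s / t) = 1 ->
  pi / 8 <= n%:R * wave_coef c s t n%:R /\
  forall k, (2 <= k)%N ->
    `|wave_coef c s t (k * n)%:R| <= wave_ratio k * wave_coef c s t n%:R.
Proof.
move=> n0 s0 t0 c0 nl cm.
have [ts|st] := leP t s.
  have cst : c * s / t = 1.
    by rewrite -cm max_r// ler_pdivlMr// ler_pM2l.
  split=> [|k k2]; first exact: (wave_coef_ge n0 s0 t0 c0 nl ts cst).
  by rewrite /wave_ratio k2; exact: (wave_coef_offdiag n0 s0 t0 c0 nl ts cst k2).
have s1 : s != 0 by rewrite gt_eqF.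
have t1 : t != 0 by rewrite gt_eqF.
have c1 : c = 1 by rewrite -cm max_l// ler_pdivrMr// ler_pM2l// ltW.
have c0' : 0 < c * s / t by rewrite divr_gt0 ?mulr_gt0.
have cst : c * s / t * t / s = 1 by rewrite -[RHS]c1; field; rewrite s1 t1.
have nl' : n%:R * (pi / (2 * t) + pi / (2 * s)) = pi by rewrite [_ + pi / (2 * s)]addrC.
have JN : wave_coef c s t n%:R = wave_coef (c * s / t) t s n%:R.
  have := @wave_coef_refl n 1 c s t s0 t0 nl.
  by rewrite !mul1n mul1r cospi opprK mul1r.
rewrite JN; split=> [|k k2]; first exact: (wave_coef_ge n0 t0 s0 c0' nl' (ltW st) cst).
rewrite (wave_coef_refl k c s0 t0 nl) normrM normrN.
apply: (@le_trans _ _ `|wave_coef (c * s / t) t s (k * n)%:R|).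
  by rewrite ler_piMl ?cos_max.
by rewrite /wave_ratio k2; exact: (wave_coef_offdiag n0 t0 s0 c0' nl' (ltW st) cst k2).
Qed.

Section eigenfunction.
Variables (n : nat) (a b : R) (u : R -> R).
Hypothesis abG : Gamma n.+1 (a, b).
Hypothesis u_eigen : normalized_fucik_eigenfunction n.+1 a b u.

Let s := Num.sqrt a.
Let t := Num.sqrt b.
Let c := u 0.

Let s0 : 0 < s. Proof. by have [] := abG; rewrite /s sqrtr_gt0. Qed.
Let t0 : 0 < t. Proof. by have [] := abG; rewrite /t sqrtr_gt0. Qed.
Let c0 : 0 < c. Proof. by have [] := u_eigen. Qed.

Let nl : n.+1%:R * (pi / (2 * s) + pi / (2 * t)) = pi.
Proof.
have [/= _ _ E] := abG; rewrite -[RHS]E -/s -/t; move: (pi) => p; field.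
by rewrite !gt_eqF.
Qed.

Let u_fucik : fucik_on (s ^+ 2) (t ^+ 2) u (derive1 u) 0 pi.
Proof.
have [/= a0 b0 _] := abG; rewrite /s /t !sqr_sqrtr ?ltW//.
have [[du ddu _ ode _] _ _] := u_eigen; have [du0 _ _] := du.
move=> x xpi; split; apply: DeriveDef.
- exact: du0.
- by rewrite derive1E.
- exact: ddu.
- by rewrite -derive1E -[LHS]opprK ode// opprB.
Qed.

Let u_cvg0 : u x @[x --> 0^'+] --> c.
Proof. by have [[[]]] := u_eigen. Qed.

Let u_cvgpi : u x @[x --> pi^'-] --> u pi.
Proof. by have [[[]]] := u_eigen. Qed.

Let u1_cvg0 : derive1 u x @[x --> 0^'+] --> 0.
Proof. by have [[_ _ _ _ []]] := u_eigen. Qed.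

(** The equation leaves the amplitude u 0 free; this relation determines it. *)
Let max_c : Num.max c (c * s / t) = 1.
Proof.
have [_ _ <-] := u_eigen; apply/esym.
exact: (fucik_sup (ltn0Sn n) s0 t0 c0 nl u_fucik u_cvg0 u1_cvg0 u_cvgpi).
Qed.

Lemma eigenfunction_L2 : L2 u.
Proof. exact: (fucik_L2 s0 t0 c0 nl u_fucik u_cvg0 u1_cvg0 u_cvgpi). Qed.

Let u_bound x : D x -> `|u x| <= 1.
Proof.
move=> Dx; rewrite -max_c.
apply: (fucik_bound s0 t0 c0 nl u_fucik u_cvg0 u1_cvg0 u_cvgpi) => //.
exact: subset_itv_oo_cc.
Qed.

Let coefE j : coef (@cosbasis R) u j =
  Num.sqrt (2 / pi) * \int[mu]_(x in D) (u x * cos (j.+1%:R * x)).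
Proof.
by rewrite /coef /cosbasis innerL2Zr//; [exact: L2_cosM|exact: eigenfunction_L2].
Qed.

Let coef_waveE j k : (k * n.+1)%N = j.+1 -> coef (@cosbasis R) u j =
  Num.sqrt (2 / pi) * n.+1%:R * wave_coef c s t (k * n.+1)%:R.
Proof.
move=> kj; rewrite coefE -kj -mulrA; congr (_ * _).
exact: (fucik_coef_dvd s0 t0 c0 nl u_fucik u_cvg0 u1_cvg0 u_cvgpi).
Qed.

Let coef_diagE : coef (@cosbasis R) u n =
  Num.sqrt (2 / pi) * n.+1%:R * wave_coef c s t n.+1%:R.
Proof. by rewrite (@coef_waveE n 1) ?mul1n. Qed.

Lemma eigenfunction_coef_ndvd j : ~~ (n.+1 %| j.+1)%N -> coef (@cosbasis R) u j = 0.
Proof.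
move=> nj; rewrite coefE.
by rewrite (fucik_coef_ndvd (ltn0Sn n) s0 t0 c0 nl u_fucik u_cvg0 u1_cvg0 u_cvgpi _ nj) ?mulr0.
Qed.

Lemma eigenfunction_coef_offdiag j k : (2 <= k)%N -> (k * n.+1)%N = j.+1 ->
  `|coef (@cosbasis R) u j| <= wave_ratio k * coef (@cosbasis R) u n.
Proof.
move=> k2 kj; rewrite (coef_waveE kj) coef_diagE normrM ger0_norm; last first.
  by rewrite mulr_ge0 ?sqrtr_ge0.
rewrite mulrCA ler_wpM2l ?mulr_ge0 ?sqrtr_ge0//.
by have [_] := wave_coef_estimates (ltn0Sn n) s0 t0 c0 nl max_c; exact.
Qed.

Lemma eigenfunction_coef_ge : Num.sqrt (2 / pi) * (pi / 8) <= coef (@cosbasis R) u n.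
Proof.
rewrite coef_diagE -mulrA ler_wpM2l ?sqrtr_ge0//.
by have [] := wave_coef_estimates (ltn0Sn n) s0 t0 c0 nl max_c.
Qed.

Lemma eigenfunction_coef_le : coef (@cosbasis R) u n <= Num.sqrt (2 / pi) * pi.
Proof.
rewrite [leRHS](_ : _ = \int[mu]_(x in D) (cst (Num.sqrt (2 / pi)) x)); last first.
  by rewrite Rintegral_cst// [X in fine X]lebesgue_dom0pi.
apply: le_Rintegral => //.
- exact: L2_integrableM eigenfunction_L2 (L2_cosbasis n).
- exact/L2_integrable/L2_cst.
move=> x Dx; rewrite (le_trans (ler_norm _))// normrM.
by rewrite (le_trans (ler_wpM2r _ (u_bound Dx)))// mul1r cosbasis_bounded.
Qed.

End eigenfunction.

Lemma eqL2_L2 u v : (forall x, D x -> u x = v x) -> L2 u -> L2 v.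
Proof.
move=> uv; rewrite /L2/= => uL; rewrite (_ : v \_ D = u \_ D)//.
by apply/funext => x; rewrite !patchE; case: ifPn => //; rewrite inE => /uv.
Qed.

Section system.
Variables (alpha beta : nat -> R) (f : nat -> R -> R).
Hypothesis hf : fucik_system alpha beta f.

Let fL2 n : L2 (f n).
Proof.
have [_ _ G E] := hf; case: n => [|n]; last exact: (eigenfunction_L2 (G n.+1 isT) (E n.+1)).
apply: (@eqL2_L2 phi0); last exact: L2_cst.
by move=> x Dx; rewrite (E 0%N)//; exact: subset_itv_oo_cc.
Qed.

Let mean n : R := Num.sqrt 2 / pi * innerL2 (f n.+1) phi0.

Definition centered n (x : R) : R := f n.+1 x - mean n.

(** [phi0] has squared norm pi / 2 and value sqrt 2 / 2, so the projection onto constants carries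
    the factor (sqrt 2 / 2) / (pi / 2) = sqrt 2 / pi. *)
Lemma centering_L2perp u : L2 u ->
  L2perp (fun x => u x - Num.sqrt 2 / pi * innerL2 u phi0).
Proof.
move=> uL2; split; first exact: L2B uL2 (L2_cst _).
rewrite innerL2Bl//; [|exact: L2_cst|exact: L2_cst].
set I := innerL2 u phi0.
rewrite (_ : innerL2 (fun=> _) phi0 = I) ?subrr// /innerL2 /phi0 Rintegral_cst//.
rewrite [X in fine X]lebesgue_dom0pi/=.
have -> : Num.sqrt 2 / pi * I * (Num.sqrt 2 / 2) * pi =
  Num.sqrt 2 ^+ 2 / 2 * (pi / pi) * I by move: (pi) (pi^-1) => p q; field.
by rewrite sqr_sqrtr// !divff ?mul1r// gt_eqF// pi_gt0.
Qed.

Let F_L2perp n : L2perp (centered n).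
Proof. exact: centering_L2perp. Qed.

Let coef_centered n : coef (@cosbasis R) (centered n) = coef (@cosbasis R) (f n.+1).
Proof.
apply/funext => j; rewrite /coef innerL2Bl//; [|exact: L2_cst|exact: L2_cosbasis].
rewrite [X in _ - X](_ : _ = 0) ?subr0// innerL2C /cosbasis innerL2Zl//; last first.
- exact: L2_cst.
- exact: L2_cosM.
by rewrite innerL2_cosM_cst mulr0.
Qed.

Let q0 : 0 < 2 / pi :> R. Proof. by rewrite divr_gt0 ?pi_gt0. Qed.
Let q1 : 2 / pi < 1 :> R. Proof. by rewrite ltr_pdivrMr ?pi_gt0// mul1r pi_gt2. Qed.
Let a0 : 0 < Num.sqrt (2 / pi) * (pi / 8) :> R.
Proof. by rewrite mulr_gt0 ?sqrtr_gt0// divr_gt0 ?pi_gt0. Qed.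

Let eigen n : Gamma n.+1 (alpha n.+1, beta n.+1) /\
  normalized_fucik_eigenfunction n.+1 (alpha n.+1) (beta n.+1) (f n.+1).
Proof. by have [_ _ G E] := hf; split; [exact: G|exact: E]. Qed.

Let F_dvd j n : ~~ (n.+1 %| j.+1)%N -> coef (@cosbasis R) (centered n) j = 0.
Proof. by rewrite coef_centered; have [G E] := eigen n; exact: eigenfunction_coef_ndvd G E j. Qed.

Let F_offdiag j n k : (2 <= k)%N -> (k * n.+1)%N = j.+1 ->
  `|coef (@cosbasis R) (centered n) j| <=
  wave_ratio k * coef (@cosbasis R) (centered n) n.
Proof.
rewrite coef_centered; have [G E] := eigen n.
exact: (eigenfunction_coef_offdiag G E).
Qed.

Let aF n : Num.sqrt (2 / pi) * (pi / 8) <= coef (@cosbasis R) (centered n) n.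
Proof. by rewrite coef_centered; have [G E] := eigen n; exact: (eigenfunction_coef_ge G E). Qed.

Let FC n : coef (@cosbasis R) (centered n) n <= Num.sqrt (2 / pi) * pi.
Proof. by rewrite coef_centered; have [G E] := eigen n; exact: (eigenfunction_coef_le G E). Qed.

Lemma centered_riesz_basis : riesz_basis_in L2perp centered.
Proof.
exact: (F_riesz_basis F_L2perp F_dvd F_offdiag wave_ratio_ge0 sum_wave_ratio q0 q1 a0 aF FC).
Qed.

Lemma fucik_complete : complete_in L2 f.
Proof.
split=> // u uL2 e e0.
have vP := centering_L2perp uL2; set m := Num.sqrt 2 / pi * innerL2 u phi0 in vP.
have [d [N dN]] := F_span_dense F_L2perp F_dvd F_offdiag wave_ratio_ge0
  sum_wave_ratio q0 q1 a0 aF FC vP (exprn_gt0 2 e0).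
have s2 : Num.sqrt 2 / 2 != 0 :> R by rewrite gt_eqF// divr_gt0// sqrtr_gt0.
(* The constant f 0 = sqrt 2 / 2 carries the mean of u less the means subtracted from the f n.
   Coefficients beyond index N are zero, so all longer partial sums agree. *)
pose c (n : nat) : R := if n is k.+1 then (k < N)%N%:R * d k
  else (m - \sum_(0 <= k < N) d k * mean k) / (Num.sqrt 2 / 2).
exists c, N => N' NN'; rewrite normL2_le ?(ltW e0)//; apply: le_trans dN.
rewrite le_eqVlt; apply/orP; left; apply/eqP; apply: eq_Rintegral => x.
rewrite inE => Dx.
suff -> : \sum_(0 <= n < N'.+1) c n * f n x = m + \sum_(0 <= n < N) d n * centered n x.
  by rewrite opprD addrA.
have [_ _ _ E] := hf; have f0x : f 0%N x = Num.sqrt 2 / 2.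
  by rewrite (E 0%N)//; exact: subset_itv_oo_cc.
have trunc : \sum_(0 <= n < N') (n < N)%N%:R * d n * f n.+1 x =
    \sum_(0 <= n < N) d n * f n.+1 x.
  rewrite [LHS](big_cat_nat (n := N))//= [X in _ + X]big_nat [X in _ + X]big1.
    rewrite addr0 big_nat [RHS]big_nat; apply: eq_bigr => n /= nN.
    by rewrite nN mul1r.
  by move=> n /andP[Nn _]; rewrite ltnNge Nn !mul0r.
rewrite big_nat_recl//= f0x divfK// trunc -addrA; congr (m + _).
rewrite addrC -sumrB; apply: eq_bigr => n _.
by rewrite /centered mulrBr.
Qed.

End system.
End fucik_systems.

Theorem theorem1p7 (R : realType) (alpha beta : nat -> R) (f : nat -> R -> R)
    (hf : fucik_system alpha beta f) :
  complete_in L2 f /\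
  riesz_basis_in L2perp
    (fun (n : nat) (x : R) =>
       f n.+1 x - Num.sqrt 2 / pi * innerL2 (f n.+1) phi0).
Proof.
split; [exact: fucik_complete hf | exact: centered_riesz_basis hf].
Qed.
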